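(* Let $\{M(t)\}$ be a generalized counting process with positive rates $\lambda_1,\dots,\lambda_k$, $\Lambda=\lambda_1+\cdots+\lambda_k$, and let $Z(t)=\inf\{s>0:B(s)=t\}$, $t>0$, be the first-passage time of a standard Brownian motion $\{B(t)\}$ independent of $\{M(t)\}$. Let $\hat M(t)=M(Z(t))$, $t>0$. The state probabilities $\hat p(n,t)=\Pr\{\hat M(t)=n\}$ satisfy the system of differential equations $$\frac{\mathrm{d}^2}{\mathrm{d}t^2}\hat p(n,t)=2\Big(\Lambda\hat p(n,t)-\sum_{j=1}^{n\wedge k}\lambda_j\hat p(n-j,t)\Big),\qquad n\ge0.$$
   Context: Generalized counting process (GCP): for $k\ge1$ and $\lambda_1,\dots,\lambda_k>0$, it is the non-negative integer valued Lévy process $\{M(t)\}_{t\ge0}$, $M(0)=0$, with $\Pr\{M(t+h)=n+j\mid M(t)=n\}=1-\Lambda h+o(h)$ for $j=0$, $=\lambda_jh+o(h)$ for $1\le j\le k$, $=o(h)$ for $j\ge k+1$, where $\Lambda=\sum_{j=1}^k\lambda_j$. Equivalently $\mathbb{E}(u^{M(t)})=\exp(-t\sum_{j=1}^k\lambda_j(1-u^j))$ for $|u|\le1$. The first-passage time $Z(t)$ has density $f(s,t)=\frac{t\,e^{-t^2/2s}}{\sqrt{2\pi s^3}}$, $s>0$. Notation: $n\wedge k=\min\{n,k\}$; an empty sum is $0$. *)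

(* Defs.v *)
From mathcomp Require Export all_boot all_order all_algebra.
From mathcomp Require Export all_classical all_reals all_analysis.
Export Order.TTheory GRing.Theory Num.Theory.
Export numFieldNormedType.Exports.

Set Implicit Arguments.
Unset Strict Implicit.
Unset Printing Implicit Defensive.

Local Open Scope classical_set_scope.
Local Open Scope ring_scope.

(* Continuous-time processes are families indexed by all of R, of which only
   the restriction to t >= 0 is ever used. *)

Section processes.
Context (d : measure_display) (Omega : measurableType d) (R : realType)
  (P : probability Omega R).

Definition mutually_independent (n : nat) (X : 'I_n -> Omega -> R) : Prop :=
  forall A : 'I_n -> set R, (forall i, measurable (A i)) ->
    P (\bigcap_(i in [set: 'I_n]) (X i @^-1` A i)) =
    (\prod_(i < n) P (X i @^-1` A i))%E.

Definition process_sigma_algebra (d' : measure_display)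
    (T : measurableType d') (X : R -> Omega -> T) : set (set Omega) :=
  <<s [set E | exists t : R, exists A : set T,
         [/\ 0 <= t, measurable A & E = X t @^-1` A]] >>.

Definition independent_processes (d1 d2 : measure_display)
    (T1 : measurableType d1) (T2 : measurableType d2)
    (X : R -> Omega -> T1) (Y : R -> Omega -> T2) : Prop :=
  forall E F : set Omega,
    process_sigma_algebra X E -> process_sigma_algebra Y F ->
    P (E `&` F) = (P E * P F)%E.

Definition independent_increments (X : R -> Omega -> R) : Prop :=
  forall (n : nat) (t : nat -> R),
    0 <= t 0%N -> {homo t : i j / (i <= j)%N >-> i <= j} ->
    mutually_independent
      (fun (i : 'I_n) (w : Omega) => X (t i.+1) w - X (t i) w).

Definition stationary_increments (X : R -> Omega -> R) : Prop :=
  forall (s h : R) (A : set R), 0 <= s -> 0 <= h -> measurable A ->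
    P ((fun w => X (s + h) w - X s w) @^-1` A) =
    P ((fun w => X h w - X 0 w) @^-1` A).

Definition cadlag (f : R -> R) : Prop :=
  (forall t : R, 0 <= t -> f s @[s --> t^'+] --> f t) /\
  (forall t : R, 0 < t -> cvg (f s @[s --> t^'-])).

(* Right-continuity of the paths and stationarity of the increments give
   stochastic continuity, which is therefore not listed. *)
Definition levy_process (X : R -> Omega -> R) : Prop :=
  [/\ forall t : R, 0 <= t -> measurable_fun setT (X t),
      forall w, X 0 w = 0,
      independent_increments X,
      stationary_increments X &
      forall w, cadlag (X ^~ w)].

Definition cond_prob (E F : set Omega) : R := fine (P (E `&` F)) / fine (P F).

Definition total_rate (k : nat) (lambda : nat -> R) : R :=
  \sum_(1 <= j < k.+1) lambda j.

(* First-order part, in h, of the probability of a jump of size j. *)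
Definition gcp_transition (k : nat) (lambda : nat -> R) (j : nat) (h : R) : R :=
  if j == 0%N then 1 - total_rate k lambda * h
  else if (j <= k)%N then lambda j * h
  else 0.

(* The conditional probabilities are only constrained when the conditioning
   event {M(t) = n} has positive probability. *)
Definition generalized_counting_process (k : nat) (lambda : nat -> R)
    (M : R -> {RV P >-> nat}) : Prop :=
  levy_process (fun t w => (M t w)%:R) /\
  forall (t : R) (n j : nat), 0 <= t -> P [set w | M t w = n] != 0%E ->
    (fun h : R =>
       cond_prob [set w | M (t + h) w = (n + j)%N] [set w | M t w = n]
       - gcp_transition k lambda j h) =o_ (0^'+) (fun h : R => h).

(* [normal_prob] takes the standard deviation as its second parameter. *)
Definition standard_brownian_motion (B : R -> {RV P >-> R}) : Prop :=
  [/\ forall w, B 0 w = 0,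
      independent_increments B,
      forall (s t : R) (A : set R), 0 <= s -> s < t -> measurable A ->
        P ((fun w => B t w - B s w) @^-1` A) =
        normal_prob 0 (Num.sqrt (t - s)) A &
      forall w, {within `[0, +oo[, continuous (fun t => B t w)}].

Definition first_passage_time (B : R -> Omega -> R) (t : R) (w : Omega)
    : \bar R :=
  ereal_inf [set s%:E | s in [set s : R | 0 < s /\ B s w = t]].

(* [fine] sends +oo to 0; this only affects the paths that never reach the
   level t, a null event for a Brownian motion. *)
Definition first_passage_subordinated (M : R -> Omega -> nat)
    (B : R -> Omega -> R) (t : R) (w : Omega) : nat :=
  M (fine (first_passage_time B t w)) w.

Definition state_prob (N : R -> Omega -> nat) (n : nat) (t : R) : R :=
  fine (P [set w | N t w = n]).

End processes.

(* Main.v *)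
Require Import Defs.
From mathcomp Require Import ring lra measurable_realfun.

(* Idea. By the reflection principle, P(Z(t) <= s) = 2 P(B(s) >= t)
   = 2 int_{y >= 1/sqrt s} K(t, y) dy with K(t, y) = t exp(- (t y)^2 / 2) / sqrt(2 pi):
   the first-passage time Z(t) is distributed as y^-2 under the density 2 K(t, y)
   on y > 0.  Writing q_n(s) = P(M(s) = n), the independence of M and B and the
   right-continuity of M give
     P(M(Z(t)) = n) = 2 int_{y > 0} q_n(y^-2) K(t, y) dy,
   where t only occurs in the Gaussian kernel.  Differentiating twice under the
   integral sign and integrating by parts in y (the second t-derivative of K is
   the y-derivative of - t y^3 exp(- (t y)^2 / 2) / sqrt(2 pi)), the second
   derivative is -4 int q_n'(y^-2) K(t, y) dy, and q_n' is given by the Kolmogorov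
   equations of the counting process. *)

Set Implicit Arguments.
Unset Strict Implicit.
Unset Printing Implicit Defensive.

Local Open Scope classical_set_scope.
Local Open Scope ring_scope.

(** * The Gaussian kernel *)

(** The variable y removes the singular factor s^(-3/2) of the density of Z(t): for t bounded away
    from 0, the kernel and its two t-derivatives share one Gaussian majorant, so |q_n| <= 1 suffices
    to differentiate under the integral. The boundary terms of the integration by parts are O(y) at
    0 and O(1/y) at infinity, so boundedness of q_n also makes them vanish. Two obstacles are
    probabilistic. The reflection principle is proved on finite grids: the first grid time above a
    level is decided by the increments up to it, hence independent of the remaining increment, whose
    law is symmetric. Path continuity and the bounded density of B(T) make the error vanish as the
    mesh shrinks. Next, {M(Z(t)) = n} evaluates M at a random time: Z(t) is rounded up to a
    countable mesh, so that independence is applied to countably many pairs of events at fixed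
    times, and the event itself is recovered as a pointwise limit. *)

Section gaussian_kernel.
Context {R : realType}.
Implicit Types a t y : R.
Let mu : {measure set (measurableTypeR R) -> \bar R} := @lebesgue_measure R.

Definition gauss_kernel t y : R :=
  normal_peak (1 : R) * (t * expR (- (t * y) ^+ 2 / 2)).

Definition gauss_kernel1 t y : R :=
  normal_peak (1 : R) * ((1 - t ^+ 2 * y ^+ 2) * expR (- (t * y) ^+ 2 / 2)).

Definition gauss_kernel2 t y : R :=
  normal_peak (1 : R) *
  ((t ^+ 3 * y ^+ 4 - 3 * t * y ^+ 2) * expR (- (t * y) ^+ 2 / 2)).

(** Common majorant, up to a factor depending on t, of the kernel and its first two t-derivatives
    for all t > a; the square absorbs the degree 4 prefactor of [gauss_kernel2]. *)
Definition gauss_bound a y : R :=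
  (1 + y ^+ 2) ^+ 2 * expR (- (a * y) ^+ 2 / 2).

Lemma is_derive_gauss_kernel t y :
  is_derive t 1 (gauss_kernel ^~ y) (gauss_kernel1 t y).
Proof.
rewrite /gauss_kernel /gauss_kernel1; apply: is_derive_eq.
rewrite /GRing.scale /=; by field.
Qed.

Lemma is_derive_gauss_kernel1 t y :
  is_derive t 1 (gauss_kernel1 ^~ y) (gauss_kernel2 t y).
Proof.
rewrite /gauss_kernel1 /gauss_kernel2; apply: is_derive_eq.
rewrite /GRing.scale /=; by field.
Qed.

Lemma gauss_bound_ge0 a y : 0 <= gauss_bound a y.
Proof. by rewrite mulr_ge0 ?expR_ge0 ?sqr_ge0. Qed.

Lemma continuous_gauss_bound a : continuous (gauss_bound a).
Proof.
move=> y; apply/differentiable_continuous/derivable1_diffP; rewrite /gauss_bound; exact: ex_derive.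
Qed.

Lemma continuous_gauss_kernel t : continuous (gauss_kernel t).
Proof.
move=> y; apply/differentiable_continuous/derivable1_diffP; rewrite /gauss_kernel; exact: ex_derive.
Qed.

Lemma continuous_gauss_kernel1 t : continuous (gauss_kernel1 t).
Proof.
move=> y; apply/differentiable_continuous/derivable1_diffP; rewrite /gauss_kernel1; exact: ex_derive.
Qed.

Lemma continuous_gauss_kernel2 t : continuous (gauss_kernel2 t).
Proof.
move=> y; apply/differentiable_continuous/derivable1_diffP; rewrite /gauss_kernel2; exact: ex_derive.
Qed.

Lemma integrable_gauss_bound a (D : set R) : 0 < a -> measurable D ->
  mu.-integrable D (EFin \o gauss_bound a).
Proof.
move=> a0 mD.
apply: (@integrableS _ _ _ _ setT) => //.
(* With b <= 1, 1 + y^2 <= b^-1 exp(b y^2), so the polynomial costs at most a constant times exp(2 b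
   y^2). With b <= a^2/8 this uses up half of the exponent -(a y)^2/2; what remains is proportional
   to the normal density of variance 2/a^2. *)
pose b := Num.min (a ^+ 2 / 8) 1.
have b0 : 0 < b by rewrite lt_min divr_gt0 ?exprn_gt0//=.
have b1 : b <= 1 by rewrite ge_min lexx orbT.
have ba : b <= a ^+ 2 / 8 by rewrite ge_min lexx.
pose s := Num.sqrt 2 / a.
have s0 : s != 0 by rewrite gt_eqF // divr_gt0 ?sqrtr_gt0.
have s2 : s ^+ 2 = 2 / a ^+ 2 by rewrite expr_div_n sqr_sqrtr.
have intg : mu.-integrable setT
    (fun y : R => ((b ^- 2 / normal_peak s)%:E * (normal_pdf 0 s y)%:E)%E).
  by apply: integrableZl => //; exact: integrable_normal_pdf.
apply: le_integrable intg => //.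
- apply/measurable_EFinP; exact: continuous_measurable_fun (@continuous_gauss_bound a).
- move=> y _; rewrite /= lee_fin ger0_norm ?gauss_bound_ge0//.
  rewrite normal_pdfE//.
  rewrite -!mulrA mulKf ?gt_eqF ?normal_peak_gt0//.
  rewrite ger0_norm ?mulr_ge0 ?expR_ge0 ?invr_ge0 ?exprn_ge0 ?(ltW b0)//.
  rewrite /normal_fun subr0 s2 /gauss_bound.
  have h1 : 1 + y ^+ 2 <= b^-1 * expR (b * y ^+ 2).
    rewrite ler_pdivlMl//; apply: le_trans (expR_ge1Dx _).
    by rewrite mulrDr mulr1 lerD2r.
  have h2 : (1 + y ^+ 2) ^+ 2 <= b ^- 2 * expR (2 * (b * y ^+ 2)).
    rewrite expRM_natl -exprVn -exprMn.
    rewrite ler_pXn2r// nnegrE ?addr_ge0 ?sqr_ge0//.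
    by rewrite mulr_ge0 ?expR_ge0 ?invr_ge0 ?(ltW b0).
  apply: le_trans (ler_wpM2r (expR_ge0 _) h2) _.
  rewrite -mulrA ler_wpM2l ?invr_ge0 ?exprn_ge0 ?(ltW b0)//.
  rewrite -expRD ler_expR.
  have -> : - y ^+ 2 / (2 / a ^+ 2 *+ 2) = - (y ^+ 2 * a ^+ 2 / 4).
    by field; rewrite gt_eqF.
  have := sqr_ge0 y; rewrite exprMn; nra.
Qed.

Lemma gauss_kernel_ge0 t y : 0 < t -> 0 <= gauss_kernel t y.
Proof.
by move=> t0; rewrite !mulr_ge0 ?expR_ge0 ?normal_peak_ge0 ?(ltW t0).
Qed.

Lemma gauss_kernels_bound a t y : 0 < a -> a < t ->
  [/\ `|gauss_kernel t y| <= normal_peak (1 : R) * t * gauss_bound a y,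
      `|gauss_kernel1 t y| <=
        normal_peak (1 : R) * (1 + t ^+ 2) * gauss_bound a y &
      `|gauss_kernel2 t y| <=
        normal_peak (1 : R) * (t ^+ 3 + 3 * t) * gauss_bound a y].
Proof.
move=> a0 at_; have t0 : 0 < t by lra.
have c0 := @normal_peak_ge0 R 1.
have He : expR (- (t * y) ^+ 2 / 2) <= expR (- (a * y) ^+ 2 / 2).
  have a2 : a ^+ 2 <= t ^+ 2 by rewrite ler_pXn2r ?nnegrE ?ltW.
  rewrite ler_expR !exprMn; have := ler_wpM2r (sqr_ge0 y) a2; lra.
have y2 := sqr_ge0 y.
(* The exponential at t is below the one at a, so each bound reduces to comparing a polynomial
   prefactor [u] with a multiple [v] of (1 + y^2)^2. *)
suff H (u v : R) : `|u| <= v * (1 + y ^+ 2) ^+ 2 ->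
    `|normal_peak 1 * (u * expR (- (t * y) ^+ 2 / 2))| <=
    normal_peak 1 * v * gauss_bound a y.
  split; apply: H.
  - rewrite ger0_norm ?(ltW t0)//; rewrite ler_peMr ?(ltW t0)//.
    by rewrite expr_ge1//; lra.
  - rewrite ler_norml; have := sqr_ge0 t; move: (t ^+ 2) (y ^+ 2) y2 => z w.
    by move=> w0 z0; apply/andP; split; nra.
  - rewrite ler_norml (_ : y ^+ 4 = (y ^+ 2) ^+ 2); last by rewrite -exprM.
    have t3 : 0 < t ^+ 3 by rewrite exprn_gt0.
    move: (t ^+ 3) t3 (y ^+ 2) y2 => z z0 w w0.
    have := mulr_ge0 (ltW z0) w0; have := mulr_ge0 (ltW t0) w0.
    have := mulr_ge0 (ltW z0) (sqr_ge0 w); have := mulr_ge0 (ltW t0) (sqr_ge0 w).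
    by move=> *; apply/andP; split; lra.
move=> uv; rewrite normrM (ger0_norm c0) -mulrA ler_wpM2l// /gauss_bound mulrA.
rewrite normrM [`|expR _|]ger0_norm ?expR_ge0//.
by apply: ler_pM => //; rewrite expR_ge0.
Qed.

End gaussian_kernel.

(** * Differentiation under the integral sign *)

Section gaussian_transform.
Context {R : realType}.
Implicit Types a t y : R.
Let mu : {measure set (measurableTypeR R) -> \bar R} := @lebesgue_measure R.

Lemma integrable_bounded_kernel (g k : R -> R) (b C a : R) (D : set R) :
  0 < a -> measurable D -> measurable_fun D g -> (forall y, D y -> `|g y| <= b) ->
  measurable_fun D k -> (forall y, D y -> `|k y| <= C * gauss_bound a y) ->
  mu.-integrable D (fun y => (g y * k y)%:E).
Proof.
move=> a0 mD mg g1 mk kC.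
have intb : mu.-integrable D (fun y : R => ((b * C)%:E * (gauss_bound a y)%:E)%E).
  by apply: integrableZl => //; exact: integrable_gauss_bound.
apply: le_integrable intb => //; first exact/measurable_EFinP/measurable_funM.
move=> y Dy; rewrite /= lee_fin normrM.
apply: le_trans (ler_norm _); rewrite -mulrA.
by apply: ler_pM => //; [exact: g1|exact: kC].
Qed.

(** On the window ]t/2, 2t[ the derivative is dominated by |C(2t)| times [gauss_bound (t / 2)],
    uniformly in the parameter because [C] is nondecreasing on positive reals. *)
Lemma is_derive_gauss_transform (g : R -> R) (k k' : R -> R -> R) (C : R -> R)
    (D : set R) t :
  measurable D -> measurable_fun D g -> (forall y, D y -> `|g y| <= 1) ->
  (forall s, measurable_fun D (k s)) ->
  (forall s y : R, is_derive s 1 (k ^~ y) (k' s y)) ->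
  {in Num.pos &, {homo C : x y / x <= y}} ->
  (forall a s y : R, 0 < a -> a < s ->
    `|k s y| <= C s * gauss_bound a y /\ `|k' s y| <= C s * gauss_bound a y) ->
  0 < t ->
  is_derive t 1 (fun s => \int[mu]_(y in D) (g y * k s y))
    (\int[mu]_(y in D) (g y * k' t y)).
Proof.
move=> mD mg g1 mk dk Cmono kC t0.
pose f s y := g y * k s y.
have df (s y : R) : is_derive s 1 (f ^~ y) (g y * k' s y).
  by have := dk s y => ?; rewrite /f; apply: is_derive_eq; rewrite /GRing.scale /= ?mulr0 ?addr0.
have df1 (s y : R) : partial1of2 f s y = g y * k' s y.
  by rewrite partial1of2E derive_val.
have tI : `](t / 2), (2 * t)[%classic t by rewrite /= in_itv /=; apply/andP; split; lra.
have fint s : `](t / 2), (2 * t)[%classic s -> mu.-integrable D (EFin \o f s).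
  rewrite /= in_itv /= => /andP[s1 s2].
  apply: (@integrable_bounded_kernel _ _ 1 (C s) (t / 2)) => //; first lra.
  by move=> y _; case: (kC (t / 2) s y) => //; lra.
have fder s y : `](t / 2), (2 * t)[%classic s -> D y -> derivable (f ^~ y) s 1.
  by move=> _ _; exact: ex_derive.
pose G y := `|C (2 * t)| * gauss_bound (t / 2) y.
have G0 y : 0 <= G y by rewrite mulr_ge0 ?gauss_bound_ge0.
have Gint : mu.-integrable D (EFin \o G).
  suff : mu.-integrable D
      (fun y : R => (`|C (2 * t)|%:E * (gauss_bound (t / 2) y)%:E)%E) by [].
  apply: integrableZl => //; apply: integrable_gauss_bound => //; lra.
have fG s y : `](t / 2), (2 * t)[%classic s -> D y ->
    `|partial1of2 f s y| <= G y.
  rewrite /= in_itv /= => /andP[s1 s2] Dy; rewrite df1 normrM.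
  have [||_ h] := kC (t / 2) s y; [lra|lra|].
  apply: le_trans (_ : `|k' s y| <= _); first by rewrite ler_piMl// g1.
  apply: le_trans h _; rewrite ler_wpM2r ?gauss_bound_ge0//.
  apply: le_trans (ler_norm _); apply: Cmono; rewrite ?posrE; lra.
have := @cvg_differentiation_under_integral R _ _ mu f D mD t (t / 2) (2 * t)
  tI fint fder G G0 Gint fG.
under [in X in _ --> X]eq_Rintegral do rewrite df1.
move=> h; apply: DeriveDef.
  apply/cvg_ex; exists (\int[mu]_(y in D) (g y * k' t y)).
  by under eq_fun do rewrite scaler1.
by apply: cvg_lim => //; under eq_fun do rewrite scaler1.
Qed.

Lemma gauss_transform_derive2 (g : R -> R) (D : set R) t :
  measurable D -> measurable_fun D g -> (forall y, D y -> `|g y| <= 1) ->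
  0 < t ->
  let F k s := \int[mu]_(y in D) (g y * k s y) in
  is_derive t 1 (F gauss_kernel) (F gauss_kernel1 t) /\
  is_derive t 1 (F gauss_kernel1) (F gauss_kernel2 t).
Proof.
move=> mD mg g1 t0 F.
(* One nondecreasing polynomial that dominates the three constants of [gauss_kernels_bound]. *)
pose C (s : R) := normal_peak (1 : R) * (1 + 3 * s + s ^+ 2 + s ^+ 3).
have c0 := @normal_peak_ge0 R 1.
have CH : {in Num.pos &, {homo C : x y / x <= y}}.
  move=> x y; rewrite !posrE => x0 y0 xy; rewrite ler_wpM2l//.
  have h n : x ^+ n <= y ^+ n by rewrite lerXn2r ?nnegrE ?(ltW x0) ?(ltW y0).
  have := h 2%N; have := h 3%N; lra.
have CB a s y : 0 < a -> a < s ->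
   [/\ `|gauss_kernel s y| <= C s * gauss_bound a y,
     `|gauss_kernel1 s y| <= C s * gauss_bound a y &
     `|gauss_kernel2 s y| <= C s * gauss_bound a y].
  move=> a0 as_; have s0 : 0 < s by lra.
  have s2 := exprn_gt0 2 s0; have s3 := exprn_gt0 3 s0.
  have [h0 h1 h2] := gauss_kernels_bound y a0 as_.
  by split; [apply: le_trans h0 _|apply: le_trans h1 _|apply: le_trans h2 _];
    rewrite ler_wpM2r ?gauss_bound_ge0// ler_wpM2l//; lra.
split; apply: (is_derive_gauss_transform (C := C)) => //.
- by move=> s; apply: measurable_funTS; exact: continuous_measurable_fun (@continuous_gauss_kernel R s).
- by move=> s y; exact: is_derive_gauss_kernel.
- by move=> a s y a0 as_; have [] := CB a s y a0 as_.
- by move=> s; apply: measurable_funTS; exact: continuous_measurable_fun (@continuous_gauss_kernel1 R s).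
- by move=> s y; exact: is_derive_gauss_kernel1.
- by move=> a s y a0 as_; have [] := CB a s y a0 as_.
Qed.

End gaussian_transform.

(** * Integration by parts against the Gaussian kernel *)

Section gauss_by_parts.
Context {R : realType}.
Implicit Types t y : R.
Let mu : {measure set (measurableTypeR R) -> \bar R} := @lebesgue_measure R.

Definition gauss_primitive t y : R :=
  normal_peak (1 : R) * (- t * y ^+ 3 * expR (- (t * y) ^+ 2 / 2)).

Lemma is_derive_gauss_primitive t y :
  is_derive y 1 (gauss_primitive t) (gauss_kernel2 t y).
Proof.
rewrite /gauss_primitive /gauss_kernel2; apply: is_derive_eq.
by rewrite /GRing.scale /=; field.
Qed.

(** Makes the boundary term at y = 0 vanish. *)
Lemma gauss_primitive_small t y : 0 < t -> 0 < y -> y <= 1 ->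
  `|gauss_primitive t y| <= normal_peak (1 : R) * t * y.
Proof.
move=> t0 y0 y1; have c0 := @normal_peak_ge0 R 1.
rewrite /gauss_primitive normrM (ger0_norm c0) -[leRHS]mulrA ler_wpM2l//.
rewrite mulNr mulNr normrN -mulrA normrM gtr0_norm// ler_pM2l//.
rewrite ger0_norm ?mulr_ge0 ?expR_ge0 ?exprn_ge0 ?(ltW y0)//.
rewrite -[leRHS]mulr1 ler_pM ?expR_ge0 ?exprn_ge0 ?(ltW y0)//.
  by rewrite exprS ler_piMr ?(ltW y0)// exprn_ile1 ?(ltW y0).
by rewrite expR_le1; have := sqr_ge0 (t * y); lra.
Qed.

(** Makes the boundary term at infinity vanish. The 16 comes from exp(-2u) <= u^-2 at u = (t y)^2/4,
    which bounds t y^3 exp(-2u) by 16/(t^3 y). *)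
Lemma gauss_primitive_large t y : 0 < t -> 0 < y ->
  `|gauss_primitive t y| <= normal_peak (1 : R) * 16 / t ^+ 3 * y^-1.
Proof.
move=> t0 y0; have c0 := @normal_peak_ge0 R 1.
rewrite /gauss_primitive normrM (ger0_norm c0) -2![leRHS]mulrA ler_wpM2l//.
rewrite mulNr mulNr normrN ger0_norm; last first.
  by rewrite !mulr_ge0 ?expR_ge0 ?exprn_ge0 ?(ltW y0) ?(ltW t0).
have u0 : 0 < (t * y) ^+ 2 / 4 by rewrite divr_gt0// exprn_gt0 ?mulr_gt0.
have -> : - (t * y) ^+ 2 / 2 = - (2 * ((t * y) ^+ 2 / 4)) by field.
have h : expR (- (2 * ((t * y) ^+ 2 / 4))) <= ((t * y) ^+ 2 / 4) ^- 2.
  rewrite expRN lef_pV2 ?posrE ?expR_gt0 ?exprn_gt0//.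
  rewrite expRM_natl ler_pXn2r ?nnegrE ?expR_ge0 ?(ltW u0)//.
  by apply: le_trans (expR_ge1Dx _); rewrite lerDr.
apply: le_trans (ler_wpM2l _ h) _.
  by rewrite !mulr_ge0 ?exprn_ge0 ?(ltW y0) ?(ltW t0).
by rewrite le_eqVlt; apply/orP; left; apply/eqP; field; rewrite !gt_eqF.
Qed.

Lemma is_derive_comp_inv_sqr (q q' : R -> R) y : 0 < y ->
  is_derive (y ^- 2) 1 q (q' (y ^- 2)) ->
  is_derive y 1 (fun x : R => q (x ^- 2)) (- 2 * y ^- 3 * q' (y ^- 2)).
Proof.
move=> y0 dq.
have y20 : y ^+ 2 != 0 by rewrite gt_eqF ?exprn_gt0.
have dinv : is_derive y 1 (fun x : R => (x ^+ 2)^-1) (- 2 * y ^- 3).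
  apply: is_derive_eq; rewrite /GRing.scale /=; field.
  by rewrite gt_eqF.
have := @is_derive1_comp _ q (fun x : R => (x ^+ 2)^-1) y _ _ dq dinv.
by rewrite mulrC.
Qed.

(** The derivative [h] of the product [H] is integrable. Its integral over compact intervals
    exhausting ]0, +oo[ tends to the full integral by dominated convergence, and to 0 because it is
    a difference of boundary values of [H]. *)
Lemma gauss_kernel2_by_parts (q q' : R -> R) (C t : R) : 0 < t ->
  (forall s : R, 0 < s -> is_derive s 1 q (q' s)) ->
  (forall s : R, 0 < s -> `|q s| <= 1) ->
  (forall s : R, 0 < s -> {for s, continuous q'}) ->
  (forall s : R, 0 < s -> `|q' s| <= C) ->
  \int[mu]_(y in `]0, +oo[) (q (y ^- 2) * gauss_kernel2 t y) =
  - 2 * \int[mu]_(y in `]0, +oo[) (q' (y ^- 2) * gauss_kernel t y).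
Proof.
move=> t0 dq q1 cq' q'C.
pose D : set R := `]0, +oo[%classic.
have mD : measurable D by exact: measurable_itv.
have D0 (y : R) : D y -> 0 < y ^- 2.
  by rewrite /D /= in_itv /= andbT => y0; rewrite invr_gt0 exprn_gt0.
have y0D (y : R) : D y -> 0 < y by rewrite /D /= in_itv /= andbT.
have cinv (y : R) : 0 < y -> {for y, continuous (fun x : R => x ^- 2)}.
  move=> y0; apply: cvgV; first by rewrite gt_eqF ?exprn_gt0.
  exact: exprn_continuous.
have cq (s : R) : 0 < s -> {for s, continuous q}.
  by move=> s0; apply/differentiable_continuous/derivable1_diffP;
    have ? := dq s s0; exact: ex_derive.
have cqi (y : R) : 0 < y -> {for y, continuous (fun x : R => q (x ^- 2))}.
  move=> y0; apply: (@continuous_comp _ _ _ (fun x : R => x ^- 2) q); first exact: cinv.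
  by apply: cq; rewrite invr_gt0 exprn_gt0.
have cq'i (y : R) : 0 < y -> {for y, continuous (fun x : R => q' (x ^- 2))}.
  move=> y0; apply: (@continuous_comp _ _ _ (fun x : R => x ^- 2) q'); first exact: cinv.
  by apply: cq'; rewrite invr_gt0 exprn_gt0.
have mcont (f : R -> R) : (forall y : R, 0 < y -> {for y, continuous f}) ->
    measurable_fun D f.
  move=> cf; apply: open_continuous_measurable_fun; first exact: interval_open.
  by move=> y; rewrite inE => /y0D; exact: cf.
(* The chain rule factor -2 y^-3 of q(y^-2) cancels the -t y^3 of [gauss_primitive], which leaves
   twice q' against the kernel. *)
pose h (y : R) := q (y ^- 2) * gauss_kernel2 t y + 2 * (q' (y ^- 2) * gauss_kernel t y).
pose H (y : R) := q (y ^- 2) * gauss_primitive t y.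
have dH (y : R) : 0 < y -> is_derive y 1 H (h y).
  move=> y0.
  have h1 := is_derive_comp_inv_sqr y0 (dq (y ^- 2) (ltac:(by rewrite invr_gt0 exprn_gt0))).
  have h2 := is_derive_gauss_primitive t y.
  apply: is_derive_eq; rewrite /h /GRing.scale /= /gauss_primitive /gauss_kernel.
  by field; rewrite gt_eqF.
have ch (y : R) : 0 < y -> {for y, continuous h}.
  move=> y0; apply: cvgD; first by apply: cvgM; [exact: cqi|exact: continuous_gauss_kernel2].
  by apply: cvgMr; apply: cvgM; [exact: cq'i|exact: continuous_gauss_kernel].
have i1 : mu.-integrable D (fun y => (q (y ^- 2) * gauss_kernel2 t y)%:E).
  apply: (@integrable_bounded_kernel _ _ _ 1 (normal_peak 1 * (t ^+ 3 + 3 * t)) (t / 2)) => //.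
  - lra.
  - exact: mcont.
  - by move=> y /D0; exact: q1.
  - by apply: mcont => y _; exact: continuous_gauss_kernel2.
  - by move=> y _; have [||_ _] := @gauss_kernels_bound _ (t / 2) t y; [lra|lra|].
have i2 : mu.-integrable D (fun y => (q' (y ^- 2) * gauss_kernel t y)%:E).
  apply: (@integrable_bounded_kernel _ _ _ C (normal_peak 1 * t) (t / 2)) => //.
  - lra.
  - exact: mcont.
  - by move=> y /D0; exact: q'C.
  - by apply: mcont => y _; exact: continuous_gauss_kernel.
  - by move=> y _; have [||] := @gauss_kernels_bound _ (t / 2) t y; [lra|lra|].
have i3 : mu.-integrable D (fun y => (2 * (q' (y ^- 2) * gauss_kernel t y))%:E).
  by under eq_fun do rewrite EFinM; exact: integrableZl.
have ih : mu.-integrable D (EFin \o h).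
  rewrite (_ : EFin \o h = (fun y => (q (y ^- 2) * gauss_kernel2 t y)%:E) \+
    (fun y => (2 * (q' (y ^- 2) * gauss_kernel t y))%:E))%E//.
  exact: integrableD.
suff h0 : \int[mu]_(y in D) h y = 0.
  by move: h0; rewrite /h RintegralD// RintegralZl// -/D; lra.
(* Starting at 2 keeps [a n] strictly below 1, so the interval up to its inverse is nondegenerate
   and [gauss_primitive_small] applies at the left end. *)
pose a n : R := n.+2%:R^-1.
have a0 n : 0 < a n by rewrite invr_gt0.
have a1 n : a n < 1 by rewrite invf_lt1// ltr1n.
pose I n : set R := `[a n, (a n)^-1]%classic.
have ID n : I n `<=` D.
  by move=> y; rewrite /I /D /= !in_itv /= andbT => /andP[+ _]; exact: lt_le_trans.
have intI n : (\int[mu]_(y in I n) (h y)%:E = (H (a n)^-1)%:E - (H (a n))%:E)%E.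
  apply: continuous_FTC2.
  - by rewrite (lt_trans (a1 n))// invf_gt1.
  - apply: continuous_in_subspaceT => y; rewrite inE => /ID /y0D; exact: ch.
  - split.
    + move=> y; rewrite in_itv /= => /andP[ay _].
      by have ? := dH y (lt_trans (a0 n) ay); exact: ex_derive.
    + apply: cvg_at_right_filter; apply/differentiable_continuous/derivable1_diffP.
      by have ? := dH _ (a0 n); exact: ex_derive.
    + apply: cvg_at_left_filter; apply/differentiable_continuous/derivable1_diffP.
      have an0 : 0 < (a n)^-1 by rewrite invr_gt0.
      by have ? := dH _ an0; exact: ex_derive.
  - move=> y; rewrite in_itv /= => /andP[ay _].
    by rewrite derive1E; have ? := dH y (lt_trans (a0 n) ay); exact: derive_val.
have acvg : a n @[n --> \oo] --> 0.
  by have := @cvg_harmonic R; rewrite -cvg_shiftS.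
have lim0 : (\int[mu]_(y in I n) (h y)%:E)%E @[n --> \oo] --> 0%E.
  under eq_fun do rewrite intI -EFinB.
  apply: cvg_EFin; first exact: nearW.
  pose B := normal_peak (1 : R) * t + normal_peak (1 : R) * 16 / t ^+ 3.
  apply/norm_cvg0P.
  apply: (@squeeze_cvgr _ _ _ _ (cst 0) (fun n => B * a n)).
  - apply: nearW => n; rewrite normr_ge0 /=.
    apply: le_trans (ler_normB _ _) _; rewrite /B mulrDl addrC lerD//.
      rewrite /H normrM; apply: le_trans (gauss_primitive_small t0 (a0 n) (ltW (a1 n))).
      by rewrite ler_piMl// q1// invr_gt0 exprn_gt0.
    have an0 : 0 < (a n)^-1 by rewrite invr_gt0.
    rewrite /H normrM; have := gauss_primitive_large t0 an0; rewrite invrK; apply: le_trans.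
    by rewrite ler_piMl// q1// invr_gt0 exprn_gt0.
  - exact: cvg_cst.
  - by rewrite -[X in _ --> X](mulr0 B); apply: cvgMr.
have lim1 : (\int[mu]_(y in I n) (h y)%:E)%E @[n --> \oo] -->
    (\int[mu]_(y in D) (h y)%:E)%E.
  have mI n : measurable (I n) by exact: measurable_itv.
  have eqI n : (\int[mu]_(y in I n) (h y)%:E =
      \int[mu]_(y in D) ((EFin \o h) \_ (I n)) y)%E.
    by rewrite -integral_mkcondr setIidr.
  rewrite (_ : (fun n => _) = (fun n => \int[mu]_(y in D) ((EFin \o h) \_ (I n)) y)%E); last first.
    by apply/funext => n; exact: eqI.
  have mh : measurable_fun D (EFin \o h) by case/integrableP: ih.
  apply: (@dominated_cvg _ _ _ mu D mD (fun n => (EFin \o h) \_ (I n)) (EFin \o h)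
    (fun y => `|(h y)%:E|%E)) => //.
  + move=> n; apply/measurable_restrict; [exact: mI|exact: mD|].
    by apply: (measurable_funS mD) => //; exact: subIsetl.
  + move=> y Dy; have y0 := y0D y Dy.
    apply: cvg_near_cst; near=> n; rewrite patchE mem_set//= /I /= in_itv /=.
    apply/andP; split; first by near: n; apply: cvgr_le acvg _ y0.
    rewrite -[y]invrK lef_pV2 ?posrE ?invr_gt0//.
    by near: n; apply: cvgr_le acvg _ _; rewrite invr_gt0.
  + exact: integrable_abse ih.
  + move=> n y Dy; rewrite patchE; case: ifPn => _ //; by rewrite abse0.
rewrite /Rintegral -(cvg_lim _ lim1)// (cvg_lim _ lim0)//.
Unshelve. all: by end_near. Qed.


End gauss_by_parts.

(** * The Kolmogorov equations of the counting process *)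

Lemma cvg_sum_ord {R : realType} (T : Type) (F : set_system T) (n : nat)
    (f : 'I_n -> T -> R) (l : 'I_n -> R) : Filter F ->
  (forall i, f i x @[x --> F] --> l i) ->
  \sum_(i < n) f i x @[x --> F] --> \sum_(i < n) l i.
Proof. by move=> FF fl; apply: cvg_big => //; exact: add_continuous. Qed.

Section generalized_counting_process_law.
Context {d : measure_display} {Omega : measurableType d} {R : realType}
  {P : probability Omega R} (k : nat) (lambda : nat -> R)
  (M : R -> {RV P >-> nat}).
Implicit Types (n m j : nat) (s h : R).

Definition marginal n s : R := fine (P [set w | M s w = n]).

Lemma measurable_marginal n s : measurable [set w | M s w = n].
Proof.
by rewrite -[X in measurable X]setTI; apply: (measurable_funP (M s) measurableT [set n]).
Qed.

Lemma marginalE n s : P [set w | M s w = n] = (marginal n s)%:E.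
Proof. by rewrite fineK// fin_num_measure//; exact: measurable_marginal. Qed.

Lemma marginal_ge0 n s : 0 <= marginal n s.
Proof. by rewrite fine_ge0. Qed.

Lemma marginal_le1 n s : marginal n s <= 1.
Proof. by rewrite -lee_fin -marginalE probability_le1//; exact: measurable_marginal. Qed.

Lemma normr_marginal n s : `|marginal n s| <= 1.
Proof. by rewrite ger0_norm ?marginal_ge0 ?marginal_le1. Qed.

Hypothesis hM : generalized_counting_process k lambda M.

Lemma gcp_start w : M 0 w = 0%N.
Proof.
have [[_ M0 _ _ _] _] := hM.
by have /eqP := M0 w; rewrite pnatr_eq0 => /eqP.
Qed.

Lemma gcp_increment_law s h (A : set R) : 0 <= s -> 0 <= h -> measurable A ->
  P [set w | A ((M (s + h) w)%:R - (M s w)%:R)] = P [set w | A (M h w)%:R].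
Proof.
move=> s0 h0 mA; have [[_ _ _ st _] _] := hM.
have := st s h A s0 h0 mA; rewrite /preimage /= => ->.
by congr (P _); apply/seteqP; split => w /=; rewrite gcp_start subr0.
Qed.

(** The times 0, s, s + h give two independent increments: the first is M(s) since M(0) = 0, the
    second has the law of M(h) by stationarity. *)
Lemma gcp_joint_law n m s h : (m <= n)%N -> 0 <= s -> 0 <= h ->
  P [set w | M s w = m /\ M (s + h) w = n] =
  (marginal m s * marginal (n - m) h)%:E.
Proof.
move=> mn s0 h0; have [[_ _ ind _ _] _] := hM.
pose t (i : nat) : R := if i is i'.+1 then if i' is 0%N then s else s + h else 0.
have t_homo : {homo t : i j / (i <= j)%N >-> i <= j}.
  by move=> [|[|i]] [|[|j]] //= _; rewrite ?addr_ge0 ?lerDl.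
pose A (i : 'I_2) : set R := if i == ord0 then [set m%:R] else [set (n - m)%N%:R].
have mA i : measurable (A i) by rewrite /A; case: ifP.
have := ind 2%N t (lexx _) t_homo A mA.
rewrite big_ord_recl big_ord1 /=.
rewrite (_ : _ @^-1` A ord0 = [set w | M s w = m]); last first.
  apply/seteqP; split => w /=; rewrite /A /= gcp_start subr0.
    by move/eqP; rewrite eqr_nat => /eqP.
  by move=> ->.
rewrite marginalE EFinM => h1.
rewrite (_ : P (_ @^-1` _) = (marginal (n - m) h)%:E) in h1; last first.
  rewrite -marginalE -[LHS]/(P [set w | A (lift ord0 ord0) ((M (s + h) w)%:R - (M s w)%:R)]).
  rewrite gcp_increment_law// /A /=; congr (P _).
  apply/seteqP; split => w /=; last by move=> ->.
  by move/eqP; rewrite eqr_nat => /eqP.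
rewrite -h1; congr (P _); apply/seteqP; split => w /=.
  move=> [sm shn] i _; rewrite /A.
  case: i => [[|[|//]]] i2 /=; first by rewrite gcp_start sm subr0.
  by rewrite shn sm natrB.
move=> H; have := H ord0 I; have := H (lift ord0 ord0) I; rewrite /A /=.
rewrite gcp_start subr0 => h2 /eqP; rewrite eqr_nat => /eqP sm; split => //.
by move/eqP: h2; rewrite sm natrB// (inj_eq (addIr _)) eqr_nat => /eqP.
Qed.

(** The increment has the law of M(h), which is a natural number, hence is almost surely
    nonnegative. *)
Lemma gcp_nondecreasing s h : 0 <= s -> 0 <= h ->
  P [set w | (M (s + h) w < M s w)%N] = 0%E.
Proof.
move=> s0 h0; have := @gcp_increment_law s h `]-oo, 0[%classic s0 h0 (measurable_itv _).
rewrite (_ : [set w | _ ((M h w)%:R)] = set0); last first.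
  by apply/seteqP; split => w //=; rewrite in_itv /= ltNge ler0n.
rewrite measure0 => <-; congr (P _); apply/seteqP; split => w /=;
  by rewrite in_itv /= subr_lt0 ltr_nat.
Qed.

(** Semigroup property of the one-dimensional laws. Values of M(s) above n contribute nothing, by
    [gcp_nondecreasing], so the sum is finite. *)
Lemma marginal_convolution n s h : 0 <= s -> 0 <= h ->
  marginal n (s + h) = \sum_(m < n.+1) marginal m s * marginal (n - m) h.
Proof.
move=> s0 h0.
pose E (m : nat) := [set w | M s w = m] `&` [set w | M (s + h) w = n].
have mE m : measurable (E m) by apply: measurableI; exact: measurable_marginal.
pose U := \big[setU/set0]_(m < n.+1) E m.
have mU : measurable U by exact: bigsetU_measurable.
have PU : P U = (\sum_(m < n.+1) marginal m s * marginal (n - m) h)%:E.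
  rewrite measure_bigsetU//; last first.
    apply/trivIsetP => i j _ _ ij; apply/seteqP; split => w //= [[si _] [sj _]].
    by move: ij; rewrite -si -sj eqxx.
  by rewrite -sumEFin; apply: eq_bigr => m _; rewrite -gcp_joint_law// -ltnS.
pose N := [set w | (M (s + h) w < M s w)%N].
have UE : U `<=` [set w | M (s + h) w = n].
  by rewrite /U -bigcup_mkord => w [m _ []].
have EU : [set w | M (s + h) w = n] `<=` U `|` N.
  move=> w /= shn; have [sh|sh] := ltnP (M (s + h) w) (M s w); [by right|left].
  by rewrite /U -bigcup_mkord; exists (M s w) => //=; rewrite ltnS -shn.
have mN : measurable N.
  have [[mM _ _ _ _] _] := hM.
  rewrite (_ : N = (fun w => (M (s + h) w)%:R - (M s w)%:R : R) @^-1` `]-oo, 0[%classic).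
    rewrite -[X in measurable X]setTI; apply: measurable_funB => //; apply: mM => //.
    exact: addr_ge0.
  by apply/seteqP; split => w /=; rewrite in_itv /= subr_lt0 ltr_nat.
apply: EFin_inj; rewrite -marginalE -PU; apply/eqP; rewrite eq_le; apply/andP; split.
  apply: (@le_trans _ _ (P (U `|` N))).
    by apply: le_measure; rewrite ?inE//; [exact: measurable_marginal|exact: measurableU].
  have PN : P N = 0%E by exact: gcp_nondecreasing.
  by rewrite -[leRHS]adde0 -PN; exact: measureU2.
by apply: le_measure; rewrite ?inE//; exact: measurable_marginal.
Qed.

Definition gcp_rate (j : nat) : R :=
  if j == 0%N then - total_rate k lambda else if (j <= k)%N then lambda j else 0.

(** At time 0 and state 0 the conditioning event is the whole space, so the defining asymptotics
    bear directly on the law of M(h); the convolution carries the rates to later times. *)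
Lemma marginal_rate j :
  (marginal j h - (j == 0%N)%:R) / h @[h --> 0^'+] --> gcp_rate j.
Proof.
have [_ /(_ 0 0%N j (lexx _))] := hM.
rewrite (_ : [set w | M 0 w = 0%N] = setT); last first.
  by apply/seteqP; split => w //= _; exact: gcp_start.
rewrite probability_setT onee_neq0 => /(_ isT)/eqoP H.
apply/cvgrPdist_le => e e0; have {}H := H _ e0; near=> h.
have h0 : 0 < h by near: h; exact: nbhs_right_gt.
have : `|marginal j h - gcp_transition k lambda j h| <= e * `|h|.
  near: h; apply: filterS H => h; apply: le_trans.
  by rewrite /cond_prob setIT probability_setT invr1 mulr1 add0r add0n.
rewrite [`|h|]gtr0_norm// => Hh.
rewrite -(ler_pM2r h0); apply: le_trans Hh.
rewrite -[X in _ * X <= _](gtr0_norm h0) -normrM mulrBl divfK; last by rewrite gt_eqF.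
rewrite distrC.
rewrite le_eqVlt; apply/orP; left; apply/eqP; congr (`|_|).
rewrite /gcp_transition /gcp_rate; case: ifP => _; last by rewrite subr0; case: ifP => _ //; rewrite mul0r.
by rewrite mulr1n; ring.
Unshelve. all: by end_near. Qed.

Lemma marginal_cvg0 j : marginal j h @[h --> 0^'+] --> ((j == 0%N)%:R : R).
Proof.
have h1 : (marginal j h - (j == 0%N)%:R) / h * h + (j == 0%N)%:R @[h --> 0^'+]
    --> gcp_rate j * 0 + (j == 0%N)%:R.
  apply: cvgD; last exact: cvg_cst.
  by apply: cvgM; [exact: marginal_rate|exact/cvg_at_right_filter/cvg_id].
move: h1; rewrite mulr0 add0r; apply: cvg_trans; apply: near_eq_cvg.
by near=> h; rewrite divfK ?subrK// gt_eqF.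
Unshelve. all: by end_near. Qed.

Lemma marginal_increment n s h : 0 <= s -> 0 <= h ->
  marginal n (s + h) - marginal n s =
  \sum_(m < n.+1) marginal m s * (marginal (n - m) h - (n - m == 0)%N%:R).
Proof.
move=> s0 h0; rewrite marginal_convolution//.
under [RHS]eq_bigr do rewrite mulrBr.
rewrite big_split /= sumrN; congr (_ - _).
rewrite big_ord_recr /= subnn mulr1 big1 ?add0r// => -[m mn] _ /=.
by rewrite subn_eq0 leqNgt mn mulr0.
Qed.

(** Prepares the left derivative, where the increment starts from the moving time s - h and the
    weights must converge too. Weights being at most 1, [marginal_increment] bounds the difference
    by the distances of the laws of M(h) to their limits at 0. *)
Lemma marginal_left_continuous n s : 0 < s ->
  marginal n (s - h) @[h --> 0^'+] --> marginal n s.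
Proof.
move=> s0; apply/cvgrPdist_le => e e0.
have : \sum_(m < n.+1) `|marginal (n - m) h - (n - m == 0)%N%:R| @[h --> 0^'+]
    --> \sum_(m < n.+1) (0 : R).
  apply: cvg_sum_ord => m; apply: norm_cvg0 => /=.
  under eq_fun do rewrite normr_id.
  apply/norm_cvg0P; apply/subr_cvg0; exact: marginal_cvg0.
rewrite big1// => /cvgrPdist_le/(_ _ e0) H; near=> h.
have h0 : 0 < h by near: h; exact: nbhs_right_gt.
have hs : h < s by near: h; exact: nbhs_right_lt.
have := @marginal_increment n (s - h) h; rewrite subr_ge0 subrK => ->; rewrite ?(ltW h0) ?(ltW hs)//.
apply: (@le_trans _ _ `|0 - \sum_(m < n.+1) `|marginal (n - m) h - (n - m == 0)%N%:R| |).
  rewrite sub0r normrN; apply: le_trans (ler_norm _).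
  apply: le_trans (ler_norm_sum _ _ _) _; apply: ler_sum => m _.
  by rewrite normrM ler_piMl ?normr_marginal.
by near: h; exact: H.
Unshelve. all: by end_near. Qed.

(** Right-hand side of the Kolmogorov forward equations; the sum stops at n because jumps are
    upward. *)
Definition marginal_derivative n s : R :=
  \sum_(m < n.+1) marginal m s * gcp_rate (n - m).

(** Substitute j = n - m: the term j = 0 carries minus the total rate, and the terms j > k vanish,
    which cuts the sum at [minn n k]. The sequence [f] is arbitrary so that the subordinated state
    probabilities can be put in. *)
Lemma sum_gcp_rate (f : nat -> R) n : \sum_(m < n.+1) f m * gcp_rate (n - m) =
  - (total_rate k lambda * f n -
     \sum_(1 <= j < (minn n k).+1) lambda j * f (n - j)%N).
Proof.
rewrite -(big_mkord xpredT (fun m => f m * gcp_rate (n - m))).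
rewrite big_nat_rev /= add0n big_nat_recl// subSS subn0 subnn /gcp_rate /=.
rewrite opprB addrC mulrN [f n * _]mulrC; congr (_ - _).
rewrite (@big_cat_nat _ _ _ (minn n k)) ?geq_minl//= [X in _ + X]big1_seq ?addr0.
  rewrite [RHS]big_add1 /= big_nat [RHS]big_nat; apply: eq_bigr => j /= jnk.
  have jn : (j < n)%N by apply: leq_trans jnk (geq_minl _ _).
  have jk : (j < k)%N by apply: leq_trans jnk (geq_minr _ _).
  by rewrite subSS subKn// jk mulrC.
move=> j /=; rewrite mem_index_iota => /andP[+ jn]; rewrite geq_min leqNgt jn /=.
by move=> kj; rewrite subSS subKn// ltnNge kj mulr0.
Qed.

(** Transitions are described forward in time, so the two one-sided quotients differ: the right one
    expands from s, the left one from s - h, with left continuity of the weights. *)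
Lemma is_derive_marginal n s : 0 < s ->
  is_derive s 1 (marginal n) (marginal_derivative n s).
Proof.
move=> s0.
have H : h^-1 * (marginal n (h + s) - marginal n s) @[h --> 0^'] -->
    marginal_derivative n s.
  apply: (@cvg_at_right_left_dnbhs _ R^o).
    have : \sum_(m < n.+1) marginal m s * ((marginal (n - m) h - (n - m == 0)%N%:R) / h)
        @[h --> 0^'+] --> marginal_derivative n s.
      by apply: cvg_sum_ord => m; apply: cvgMr; exact: marginal_rate.
    apply: cvg_trans; apply: near_eq_cvg; near=> h.
    have h0 : 0 < h by near: h; exact: nbhs_right_gt.
    rewrite [h + s]addrC marginal_increment ?(ltW h0) ?(ltW s0)// mulr_sumr.
    by apply: eq_bigr => m _; rewrite mulrA mulrC.
  have : \sum_(m < n.+1) marginal m (s - h) * ((marginal (n - m) h - (n - m == 0)%N%:R) / h)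
      @[h --> 0^'+] --> marginal_derivative n s.
    by apply: cvg_sum_ord => m; apply: cvgM; [exact: marginal_left_continuous|exact: marginal_rate].
  move=> Hl; apply/cvg_at_leftNP; rewrite oppr0; move: Hl.
  apply: cvg_trans; apply: near_eq_cvg; near=> h.
  have h0 : 0 < h by near: h; exact: nbhs_right_gt.
  have hs : h < s by near: h; exact: nbhs_right_lt.
  have := @marginal_increment n (s - h) h; rewrite subr_ge0 subrK => Hinc.
  rewrite /= invrN mulNr -mulrN opprB [- h + s]addrC Hinc ?(ltW h0) ?(ltW hs)// mulr_sumr.
  by apply: eq_bigr => m _; rewrite mulrA mulrC.
apply: DeriveDef; first by apply/cvg_ex; exists (marginal_derivative n s); under eq_fun do rewrite scaler1.
by apply: cvg_lim => //; under eq_fun do rewrite scaler1.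
Unshelve. all: by end_near. Qed.

Lemma continuous_marginal n s : 0 < s -> {for s, continuous (marginal n)}.
Proof.
move=> s0; apply/differentiable_continuous/derivable1_diffP.
by have ? := is_derive_marginal n s0; exact: ex_derive.
Qed.

Lemma continuous_marginal_derivative n s : 0 < s ->
  {for s, continuous (marginal_derivative n)}.
Proof.
move=> s0; apply: cvg_sum_ord => m; apply: cvgMl; exact: continuous_marginal.
Qed.

Lemma normr_marginal_derivative n s :
  `|marginal_derivative n s| <= \sum_(m < n.+1) `|gcp_rate (n - m)|.
Proof.
apply: le_trans (ler_norm_sum _ _ _) _; apply: ler_sum => m _.
by rewrite normrM ler_piMl ?normr_marginal.
Qed.




End generalized_counting_process_law.

(** * The reflection principle *)

Section continuous_paths.
Context {R : realType} (b : R -> R).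
Hypothesis cb : {within `[0, +oo[, continuous b}.
Implicit Types (a e r s T : R) (m i : nat).

Definition grid T m i : R := i%:R * T / m.+1%:R.

Lemma grid0 T m : grid T m 0 = 0.
Proof. by rewrite /grid !mul0r. Qed.

Lemma grid_max T m : grid T m m.+1 = T.
Proof. by rewrite /grid mulrC mulKf ?pnatr_eq0. Qed.

Lemma gridS T m i : grid T m i.+1 = grid T m i + T / m.+1%:R.
Proof. by rewrite /grid -natr1 !mulrDl mul1r. Qed.

Lemma grid_ge0 T m i : 0 <= T -> 0 <= grid T m i.
Proof. by move=> T0; rewrite /grid divr_ge0 ?mulr_ge0. Qed.

Lemma grid_homo T m : 0 <= T -> {homo grid T m : i j / (i <= j)%N >-> i <= j}.
Proof.
by move=> T0 i j ij; rewrite /grid ler_pM2r ?invr_gt0// ler_wpM2r// ler_nat.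
Qed.

Lemma path_near r e : 0 <= r -> 0 < e ->
  exists2 delta : R, 0 < delta &
    forall r', 0 <= r' -> `|r - r'| < delta -> `|b r - b r'| < e.
Proof.
move=> r0 e0.
have /subspace_continuousP /(_ r) := cb.
rewrite /= in_itv /= r0 => /(_ isT) /cvgrPdist_lt /(_ _ e0) [delta /= d0 H].
by exists delta => // r' r'0 rr'; apply: H => //=; rewrite in_itv /= r'0.
Qed.

Lemma mesh_near T e : 0 < e -> \forall m \near \oo, T / m.+1%:R < e.
Proof.
move=> e0.
have : T * m.+1%:R^-1 @[m --> \oo] --> T * 0 by apply: cvgMr; exact: (@cvg_harmonic R).
by rewrite mulr0 => /cvgr_lt; apply.
Qed.

(** Uniform continuity on [0, T]: eventually no grid increment overshoots by e. *)
Lemma path_increment_near T e : 0 <= T -> 0 < e ->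
  \forall m \near \oo, forall i, (i <= m)%N ->
    b (grid T m i.+1) - b (grid T m i) < e.
Proof.
move=> T0 e0.
(* Compactness is used in near-covering form: [Q] speaks of every grid point close to [x], which
   makes it a local property, and it is finally instantiated at the grid point itself. *)
pose Q m x := forall i, (i <= m)%N -> `|x - grid T m i| <= T / m.+1%:R ->
  b (grid T m i.+1) - b (grid T m i) < e.
have /compact_near_coveringP := @segment_compact R 0 T.
move=> /(_ _ \oo Q _) H.
have {}H : \forall m \near \oo, `[0, T]%classic `<=` Q m.
  suff Hx (x : R) : 0 <= x -> \forall x' \near x & m \near \oo, Q m x'.
    by apply: H => x /=; rewrite in_itv /= => /andP[x0 _]; exact: Hx.
  move=> x0.
  have e20 : 0 < e / 2 by rewrite divr_gt0.
  have [delta d0 Hd] := path_near x0 e20.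
  (* Three errors are added: from [x] to [x'], from [x'] to the grid point, and one mesh step to the
     next grid point. *)
  have d30 : 0 < delta / 3 by rewrite divr_gt0.
  near=> x' m => i /= im xi.
  have hm : T / m.+1%:R < delta / 3 by near: m; exact: mesh_near.
  have hx : `|x - x'| < delta / 3.
    by near: x'; apply/nbhs_ballP; exists (delta / 3).
  have h1 : `|x - grid T m i| < delta.
    rewrite -(subrK x' x) -addrA; apply: le_lt_trans (ler_normD _ _) _.
    by have := le_lt_trans xi hm; move: hx; lra.
  have h2 : `|x - grid T m i.+1| < delta.
    rewrite gridS opprD addrA -(subrK x' x) -2!addrA.
    apply: le_lt_trans (ler_normD _ _) _.
    rewrite addrA; have := ler_normB (x' - grid T m i) (T / m.+1%:R).
    rewrite [`|T / _|]ger0_norm ?divr_ge0//.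
    by have := le_lt_trans xi hm; move: hm hx; move: (T / _) => u; lra.
  have := Hd _ (grid_ge0 _ _ T0) h1; have := Hd _ (grid_ge0 _ _ T0) h2.
  rewrite !ltr_norml => /andP[? ?] /andP[? ?]; lra.
near=> m => i im.
have : `[0, T]%classic `<=` Q m by near: m; exact: H.
move=> /(_ (grid T m i)) /=; rewrite in_itv /= grid_ge0//=.
have -> : grid T m i <= T by rewrite -[leRHS](grid_max T m) grid_homo// leqW.
by move=> /(_ isT i im); rewrite subrr normr0 divr_ge0//; apply.
Unshelve. all: by end_near. Qed.

Lemma grid_approx T m r : 0 < T -> 0 <= r -> r <= T ->
  exists2 i, (i <= m.+1)%N & `|r - grid T m i| <= T / m.+1%:R.
Proof.
move=> T0 r0 rT.
have mT : 0 < T / m.+1%:R by rewrite divr_gt0.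
pose i := Num.truncn (r / (T / m.+1%:R)).
have x0 : 0 <= r / (T / m.+1%:R) by rewrite divr_ge0// ltW.
have /andP[h1 h2] := truncn_itv x0.
have gi : grid T m i = i%:R * (T / m.+1%:R) by rewrite /grid mulrA.
rewrite ler_pdivlMr// -gi in h1; rewrite ltr_pdivrMr// in h2.
exists i.
  rewrite -(ler_nat R) -(ler_pM2r mT) -gi; apply: le_trans h1 _.
  by rewrite mulrC mulfVK ?pnatr_eq0.
rewrite -natr1 mulrDl mul1r -gi in h2.
rewrite ler_norml; move: mT h1 h2; move: (T / _) => u *.
by apply/andP; split; lra.
Qed.

Lemma path_reaches_near T a e : 0 < T -> 0 < e ->
  (exists r, [/\ 0 <= r, r <= T & a <= b r]) ->
  \forall m \near \oo, exists2 i, (i <= m.+1)%N & a - e <= b (grid T m i).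
Proof.
move=> T0 e0 [r [r0 rT ar]].
have [delta d0 Hd] := path_near r0 e0.
near=> m.
have hm : T / m.+1%:R < delta by near: m; exact: mesh_near.
have [i im hi] := @grid_approx T m r T0 r0 rT; exists i => //.
have := Hd _ (grid_ge0 m i (ltW T0)) (le_lt_trans hi hm).
by rewrite ltr_norml => /andP[? ?]; lra.
Unshelve. all: by end_near. Qed.

(** The maximum over the compact [0, T] is attained, so reaching every level below [a] means
    reaching [a]. *)
Lemma path_reachesP T a : 0 <= T ->
  (forall e, 0 < e -> exists r, [/\ 0 <= r, r <= T & a - e <= b r]) ->
  exists r, [/\ 0 <= r, r <= T & a <= b r].
Proof.
move=> T0 H.
have cT : {within `[0, T], continuous b}.
  by apply: continuous_subspaceW cb => x /=; rewrite !in_itv /= andbT => /andP[].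
have [c cT0 cmax] := EVT_max T0 cT.
move: cT0; rewrite in_itv /= => /andP[c0 cT1].
exists c; split => //; apply/ler_addgt0Pr => e e0.
have [r [r0 rT ar]] := H e e0.
have := cmax r; rewrite in_itv /= r0 rT => /(_ isT); lra.
Qed.

(** If the path exceeds [a] by time s, the intermediate value theorem gives a time at which it
    equals [a]. Conversely, an infimum at most s gives passages before s or arbitrarily little after
    it; continuity at s and [path_reachesP] conclude without attainment of the infimum. *)
Lemma first_passage_leP a s : b 0 = 0 -> 0 < a -> 0 <= s ->
  (ereal_inf [set r%:E | r in [set r : R | (0 < r)%R /\ b r = a]] <= s%:E)%E <->
  exists r, [/\ 0 <= r, r <= s & a <= b r].
Proof.
move=> b0 a0 s0; split; last first.
  move=> [r [r0 rs ar]].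
  have cr : {within `[0, r], continuous b}.
    by apply: continuous_subspaceW cb => x /=; rewrite !in_itv /= andbT => /andP[].
  have [|c] := IVT (v := a) r0 cr.
    by rewrite b0 ge_min le_max (ltW a0) ar orbT.
  rewrite in_itv /= => /andP[c0 cr1] bc.
  apply: (@le_trans _ _ c%:E); last by rewrite lee_fin (le_trans cr1).
  apply: ereal_inf_lbound; exists c => //=; split => //.
  by rewrite lt_neqAle c0 andbT; apply: contra_eq_neq bc => <-; rewrite b0 lt_eqF.
move=> Z; apply: path_reachesP => // e e0.
have [delta d0 Hd] := path_near s0 e0.
have : (ereal_inf [set r%:E | r in [set r : R | (0 < r)%R /\ b r = a]] < (s + delta)%:E)%E.
  by apply: le_lt_trans Z _; rewrite lte_fin ltrDl.
move/ereal_inf_lt => [_ [r [r0 br] <-]]; rewrite lte_fin => rs.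
have [rs1|rs1] := leP r s; first by exists r; split => //; [exact: ltW|lra].
exists s; split => //.
have sr : `|s - r| < delta by rewrite ltr_norml; apply/andP; split; lra.
by have := Hd r (ltW r0) sr; rewrite br ltr_norml => /andP[? _]; lra.
Qed.

End continuous_paths.

(** * Independence of an increment from the past *)

Section past_independence.
Context {d : measure_display} {Omega : measurableType d} {R : realType}
  {P : probability Omega R}.
Implicit Types (E F : set Omega) (X Z : R -> Omega -> R) (n : nat).

Definition cylinder (X : nat -> Omega -> R) n : set (set Omega) :=
  [set E | exists2 A : nat -> set R, forall j, measurable (A j) &
    E = \bigcap_(j in `I_n) X j @^-1` A j].

Lemma cylinder_setI (X : nat -> Omega -> R) n : setI_closed (cylinder X n).
Proof.
move=> _ _ [A mA ->] [A' mA' ->]; exists (fun j => A j `&` A' j).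
  by move=> j; exact: measurableI.
rewrite -bigcapI; apply: eq_bigcapr => j _; by rewrite preimage_setI.
Qed.

Lemma measurable_cylinder (X : nat -> Omega -> R) n :
  (forall j, measurable_fun setT (X j)) -> cylinder X n `<=` measurable.
Proof.
move=> mX _ [A mA ->]; apply: bigcap_measurableType => j _.
by rewrite -[X in measurable X]setTI; exact: mX.
Qed.

Lemma cylinder_sigma_measurable (X : nat -> Omega -> R) n :
  (forall j, measurable_fun setT (X j)) -> <<s cylinder X n >> `<=` measurable.
Proof.
move=> mX; apply: smallest_sub; last exact: measurable_cylinder.
exact: sigma_algebra_measurable.
Qed.

(** Cylinders form a pi-system, on which the finite measures [m1] (P restricted to [F]) and [m2] (P
    scaled by the probability of [F]) agree; hence they agree on the generated sigma-algebra. *)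
Lemma cylinder_independent (X : nat -> Omega -> R) n F :
  (forall j, measurable_fun setT (X j)) -> measurable F ->
  (forall E, cylinder X n E -> P (E `&` F) = (P E * P F)%E) ->
  forall E, <<s cylinder X n >> E -> P (E `&` F) = (P E * P F)%E.
Proof.
move=> mX mF H E sE.
have PF0 : 0 <= fine (P F) by rewrite fine_ge0.
pose m1 := mrestr P mF.
pose m2 := mscale (NngNum PF0) P.
have PFE : P F = (fine (P F))%:E by rewrite fineK// fin_num_measure.
have -> : (P E * P F)%E = m2 E by rewrite /m2 /mscale /= -PFE muleC.
have -> : P (E `&` F) = m1 E by [].
have GT : cylinder X n setT.
  exists (fun=> setT) => //; apply/seteqP; split => //.
apply: (g_sigma_algebra_measure_unique (cylinder X n) (measurable_cylinder mX)
  (fun=> setT)) => //.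
- by rewrite bigcup_const.
- exact: cylinder_setI.
- by move=> A GA; transitivity (P (A `&` F)) => //; rewrite H// {1}PFE muleC.
- move=> k; suff : (P (setT `&` F) < +oo)%E by []; by rewrite setTI ltey_eq fin_num_measure.
Qed.

Definition increments X (t : nat -> R) (j : nat) (w : Omega) : R :=
  X (t j.+1) w - X (t j) w.

Lemma increments_past_independent X (t : nat -> R) n u (C : set R) E :
  (forall s, measurable_fun setT (X s)) -> independent_increments P X ->
  0 <= t 0%N -> {homo t : i j / (i <= j)%N >-> i <= j} -> t n <= u ->
  measurable C ->
  <<s cylinder (increments X t) n >> E ->
  P (E `&` [set w | C (X u w - X (t n) w)%R]) =
  (P E * P [set w | C (X u w - X (t n) w)%R])%E.
Proof.
move=> mX ind t0 ht tu mC; apply: cylinder_independent.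
- by move=> j; exact: measurable_funB.
- rewrite -[X in measurable X]setTI.
  by have := measurable_funB (mX u) (mX (t n)); apply.
move=> _ [A mA ->].
(* Appending [u] after [t n] makes the future increment the one of index n, so that mutual
   independence covers past and future together. *)
pose t' j := if (j <= n)%N then t j else u.
have ht' : {homo t' : i j / (i <= j)%N >-> i <= j}.
  move=> i j ij; rewrite /t'; case: ifPn => i1; case: ifPn => j1 //.
  - exact: ht.
  - by apply: le_trans tu; exact: ht.
  - by move: i1; rewrite (leq_trans ij j1).
(* Kept general in [D]: the whole line gives the probability of the cylinder as a product, and [C]
   gives the joint probability. *)
have key (D : set R) : measurable D ->
    P ((\bigcap_(j in `I_n) (increments X t j @^-1` A j)) `&`
       [set w | D (X u w - X (t n) w)%R]) =
    ((\prod_(j < n) P (increments X t j @^-1` A j)) *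
      P [set w | D (X u w - X (t n) w)%R])%E.
  move=> mD; pose A' (j : 'I_n.+1) := if (j < n)%N then A j else D.
  have mA' j : measurable (A' j) by rewrite /A'; case: ifP.
  have := ind n.+1 t' t0 ht' A' mA'.
  rewrite big_ord_recr /= => h.
  transitivity (P (\bigcap_(i in [set: 'I_n.+1])
    (fun w => X (t' i.+1) w - X (t' i) w) @^-1` A' i)).
    congr (P _); apply/seteqP; split => w /=.
      move=> [h1 h2] i _; have iln : (i <= n)%N by rewrite -ltnS ltn_ord.
      rewrite /t' /A' /= iln; case: ifPn => iN; first by apply: h1.
      have -> : nat_of_ord i = n by apply/eqP; rewrite eqn_leq iln leqNgt iN.
      by [].
    move=> h1; split.
      move=> j /= jn; have := h1 (widen_ord (leqnSn n) (Ordinal jn)) I.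
      by rewrite /t' /A' /= jn (ltnW jn).
    by have := h1 ord_max I; rewrite /t' /A' /= !ltnn leqnn.
  rewrite h; congr (_ * _)%E; last first.
    by congr (P _); rewrite /t' /A' /= ltnn leqnn.
  by apply: eq_bigr => j _; rewrite /t' /A' /= (ltnW (ltn_ord j)) ltn_ord.
have := key setT measurableT.
rewrite (_ : [set w | setT (X u w - X (t n) w)%R] = setT)//.
rewrite setIT probability_setT mule1 => ->.
exact: key.
Qed.

(** The path vanishes at the initial time, so X(t j) telescopes into the sum of its first j
    increments. *)
Lemma measurable_past X (t : nat -> R) n j (C : set R) :
  (forall w, X (t 0%N) w = 0) -> (j <= n)%N -> measurable C ->
  <<s cylinder (increments X t) n >> [set w | C (X (t j) w)].
Proof.
move=> X0 jn mC.
pose T := g_sigma_algebraType (cylinder (increments X t) n).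
have mincr i : (i < n)%N -> measurable_fun setT (increments X t i : T -> R).
  move=> ilt _ D mD; rewrite setTI; apply: sub_sigma_algebra.
  exists (fun l => if l == i then D else setT); first by move=> l; case: ifP.
  apply/seteqP; split => w /= h.
    by move=> l _ /=; case: eqP => [->|].
  by have := h i ilt; rewrite /= eqxx.
have sumE (w : T) : X (t j) w = \sum_(i < j) increments X t i w.
  elim: (j) => [|l IH]; first by rewrite big_ord0.
  by rewrite big_ord_recr -IH /= /increments addrC subrK.
have : measurable_fun setT (fun w : T => \sum_(i < j) increments X t i w).
  by apply: measurable_sum => i; apply: mincr; exact: leq_trans jn.
move=> /(_ measurableT C mC); rewrite setTI => h.
rewrite (_ : [set w | _] = (fun w : T => \sum_(i < j) increments X t i w) @^-1` C)//.
by apply/seteqP; split => w /=; rewrite sumE.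
Qed.

Definition first_entrance X (t : nat -> R) (a : R) n : set Omega :=
  [set w | (forall j, (j < n)%N -> X (t j) w < a) /\ a <= X (t n) w].

(** The stopping-time property: entering at step n is decided by the positions up to n, hence by the
    first n increments. *)
Lemma measurable_first_entrance X (t : nat -> R) a n :
  (forall w, X (t 0%N) w = 0) ->
  <<s cylinder (increments X t) n >> (first_entrance X t a n).
Proof.
move=> X0.
pose T := g_sigma_algebraType (cylinder (increments X t) n).
have -> : first_entrance X t a n =
    (\bigcap_(j in `I_n) [set w | `]-oo, a[%classic (X (t j) w)]) `&`
    [set w | `[a, +oo[%classic (X (t n) w)].
  apply/seteqP; split => w /=; rewrite in_itv /= andbT.
    by move=> [h1 h2]; split => // j /= jn; rewrite in_itv /= h1.
  by move=> [h1 h2]; split => // j jn; have := h1 j jn; rewrite /= in_itv.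
apply: (@measurableI _ T).
  apply: (@bigcap_measurableType _ T) => j jn.
  by apply: measurable_past => //; exact: ltnW.
by apply: measurable_past.
Qed.

End past_independence.

(** * Real-valued probabilities *)

Section real_probability.
Context {d : measure_display} {Omega : measurableType d} {R : realType}
  (P : probability Omega R).
Implicit Types A C : set Omega.

Definition rprob A : R := fine (P A).

Local Notation pr := rprob.

Lemma prE A : measurable A -> P A = (pr A)%:E.
Proof. by move=> mA; rewrite fineK// fin_num_measure. Qed.

Lemma pr_ge0 A : 0 <= pr A.
Proof. by rewrite fine_ge0. Qed.

Lemma pr_mono A C : measurable A -> measurable C -> A `<=` C -> pr A <= pr C.
Proof.
by move=> mA mC AC; rewrite -lee_fin -!prE//; apply: le_measure; rewrite ?inE.
Qed.

Lemma pr_setU A C : measurable A -> measurable C -> pr (A `|` C) <= pr A + pr C.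
Proof.
move=> mA mC; rewrite -lee_fin EFinD -!prE//; first exact: measureU2.
exact: measurableU.
Qed.

Lemma pr_bigcup (F : nat -> set Omega) n : (forall i, measurable (F i)) ->
  trivIset setT F -> pr (\bigcup_(i in `I_n) F i) = \sum_(i < n) pr (F i).
Proof.
move=> mF tF; apply: EFin_inj; rewrite -prE; last exact: bigcup_measurable.
rewrite bigcup_mkord measure_bigsetU// -sumEFin.
by apply: eq_bigr => i _; rewrite -prE.
Qed.

(** Dominated convergence for the indicators, with majorant 1; the events need not be nested. *)
Lemma pr_cvg0 (F : nat -> set Omega) : (forall i, measurable (F i)) ->
  (forall w, \forall i \near \oo, ~ F i w) -> pr (F i) @[i --> \oo] --> 0.
Proof.
move=> mF HF.
have : (\int[P]_w (\1_(F i) w)%:E)%E @[i --> \oo] --> (\int[P]_w (cst 0 w : \bar R))%E.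
  apply: (@dominated_cvg _ _ _ P setT measurableT (fun i w => (\1_(F i) w)%:E)
    (cst 0%E) (cst 1%E)) => //.
  - by move=> i; apply/measurable_EFinP; exact: measurable_indic.
  - move=> w _; apply: cvg_near_cst; near=> i; rewrite indicE memNset//.
    by near: i; exact: HF.
  - exact: finite_measure_integrable_cst.
  - by move=> i w _; rewrite /= lee_fin indicE; case: (w \in _); rewrite ?normr1 ?normr0.
rewrite integral0 => /fine_cvg; apply: cvg_trans; apply: near_eq_cvg.
by near=> i; rewrite /= integral_indic// setIT.
Unshelve. all: by end_near. Qed.

End real_probability.

(** * Centred normal laws *)

Section centered_normal.
Context {R : realType}.
Implicit Types s x y : R.
Let mu : {measure set (measurableTypeR R) -> \bar R} := @lebesgue_measure R.

Lemma normal_prob_half s : s != 0 -> normal_prob 0 s `[0, +oo[%classic = (2^-1)%:E.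
Proof.
move=> s0.
have h : normal_prob 0 s setT =
    (2%:E * normal_prob 0 s [set x | (0 <= x)%R])%E.
  apply: ge0_symfun_integralT.
  - by move=> x; exact: normal_pdf_ge0.
  - exact: continuous_normal_pdf.
  - move=> x; rewrite normal_pdfE//= /normal_fun !subr0 sqrrN //.
have <- : [set x : R | (0 <= x)%R] = `[0, +oo[%classic.
  by apply/seteqP; split => x /=; rewrite in_itv /= andbT.
rewrite probability_setT in h.
have mA : measurable [set x : R | (0 <= x)%R] by rewrite -set_itvcy.
move: h; rewrite (@prE _ _ _ (normal_prob 0 s) _ mA) -EFinM => -[h].
by congr (_%:E); lra.
Qed.

Lemma normal_prob_itv_le s x y : s != 0 -> x <= y ->
  (normal_prob 0 s `[x, y[%classic <= (normal_peak s * (y - x))%:E)%E.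
Proof.
move=> s0 xy; rewrite /normal_prob.
apply: (@le_trans _ _ (\int[mu]_(z in `[x, y[) (normal_peak s)%:E)%E).
  apply: ge0_le_integral => //=.
  - by move=> z _; rewrite lee_fin normal_pdf_ge0.
  - by apply/measurable_EFinP/measurable_funTS; exact: measurable_normal_pdf.
  - by move=> z _; rewrite lee_fin normal_pdf_ub.
rewrite integral_cst//= /mu lebesgue_measure_itv /= lte_fin.
case: ltP => [_|yx]; first by rewrite -EFinD -EFinM.
by rewrite mule0 lee_fin mulr_ge0 ?normal_peak_ge0 ?subr_ge0.
Qed.

End centered_normal.

(** * Levy's inequalities on a grid and their limit *)

Section reflection_principle.
Context {d : measure_display} {Omega : measurableType d} {R : realType}
  {P : probability Omega R} (B : R -> {RV P >-> R}).
Hypothesis hB : standard_brownian_motion B.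
Variables (T a : R).
Hypotheses (T0 : 0 < T) (a0 : 0 < a).
Implicit Types (m i : nat) (e s x : R).

Local Notation pr := (rprob P).

Lemma brownian_measurable s (C : set R) : measurable C ->
  measurable [set w | C (B s w)].
Proof.
by move=> mC; rewrite -[X in measurable X]setTI; exact: (measurable_funP (B s)).
Qed.

Lemma brownian_increment_measurable s r (C : set R) : measurable C ->
  measurable [set w | C (B s w - B r w)].
Proof.
move=> mC; rewrite -[X in measurable X]setTI.
by have := measurable_funB (measurable_funP (B s)) (measurable_funP (B r)); apply.
Qed.

Lemma brownian_path w : {within `[0, +oo[, continuous (fun s => B s w)}.
Proof. by have [_ _ _] := hB. Qed.

Lemma brownian0 w : B 0 w = 0.
Proof. by have [-> _ _ _] := hB. Qed.

Lemma brownian_law s (C : set R) : 0 < s -> measurable C ->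
  P [set w | C (B s w)] = normal_prob 0 (Num.sqrt s) C.
Proof.
move=> s0 mC; have [_ _ law _] := hB.
rewrite -[X in Num.sqrt X]subr0 -law//; congr (P _).
by apply/seteqP; split => w /=; rewrite brownian0 subr0.
Qed.

Lemma brownian_increment_half r : 0 <= r -> r < T ->
  pr [set w | 0 <= B T w - B r w] = 2^-1.
Proof.
move=> r0 rT; have [_ _ law _] := hB.
have <- : [set w | `[0, +oo[%classic (B T w - B r w)] = [set w | 0 <= B T w - B r w].
  by apply/seteqP; split => w /=; rewrite in_itv /= andbT.
apply: EFin_inj; rewrite -prE; last exact: brownian_increment_measurable.
rewrite -[LHS]/(P ((fun w => B T w - B r w) @^-1` `[0, +oo[%classic)) law//.
by rewrite normal_prob_half// sqrtr_eq0 -ltNge subr_gt0.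
Qed.

Definition grid_hit m x : set Omega :=
  \bigcup_(i in `I_m.+2) [set w | x <= B (grid T m i) w].

Definition grid_jump m e : set Omega :=
  \bigcup_(i in `I_m.+1) [set w | e <= B (grid T m i.+1) w - B (grid T m i) w].

Lemma measurable_ge s x : measurable [set w | x <= B s w].
Proof.
rewrite (_ : [set w | _] = [set w | `[x, +oo[%classic (B s w)]).
  exact: brownian_measurable.
by apply/seteqP; split => w /=; rewrite in_itv /= andbT.
Qed.

Lemma measurable_incr_ge s r x : measurable [set w | x <= B s w - B r w].
Proof.
rewrite (_ : [set w | _] = [set w | `[x, +oo[%classic (B s w - B r w)]).
  exact: brownian_increment_measurable.
by apply/seteqP; split => w /=; rewrite in_itv /= andbT.
Qed.

Lemma measurable_grid_hit m x : measurable (grid_hit m x).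
Proof. by apply: bigcup_measurable => i _; exact: measurable_ge. Qed.

Lemma measurable_grid_jump m e : measurable (grid_jump m e).
Proof. by apply: bigcup_measurable => i _; exact: measurable_incr_ge. Qed.

Let A m x i := first_entrance (fun s w => B s w) (grid T m) x i.

Let measurable_A m x i : measurable (A m x i).
Proof.
apply: (@cylinder_sigma_measurable _ _ _ (increments (fun s w => B s w) (grid T m)) i).
  by move=> j; exact: measurable_funB.
by apply: measurable_first_entrance => w; rewrite grid0 brownian0.
Qed.

Let trivIset_A m x : trivIset setT (A m x).
Proof.
apply/trivIsetP => i j _ _; rewrite neq_ltn => /orP[] ij;
  apply/seteqP; split => w //= [[h1 h2] [h3 h4]].
  by have := h3 i ij; rewrite ltNge h2.
by have := h1 j ij; rewrite ltNge h4.
Qed.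

Let A_exists m x i w : x <= B (grid T m i) w -> exists2 j, (j <= i)%N & A m x j w.
Proof.
move=> xi; have ex : exists j, x <= B (grid T m j) w by exists i.
have [j hj jmin] := ex_minnP ex; exists j; first exact: jmin.
split => // l lj; rewrite ltNge; apply/negP => /jmin; by rewrite leqNgt lj.
Qed.

Let grid_hitE m x : grid_hit m x = \bigcup_(i in `I_m.+2) A m x i.
Proof.
apply/seteqP; split => w [i /= im].
  by move=> /A_exists[j ji Aj]; exists j => //=; exact: leq_ltn_trans im.
by move=> [_ h]; exists i.
Qed.

(** First entrance at i, then ending no lower: B(T) >= x holds on this event, and independence of
    the remaining increment makes it half as likely as [A] for i <= m. *)
Let A' m x i := A m x i `&` [set w | 0 <= B T w - B (grid T m i) w].

Let measurable_A' m x i : measurable (A' m x i).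
Proof. by apply: measurableI; [exact: measurable_A|exact: measurable_incr_ge]. Qed.

Let trivIset_A' m x : trivIset setT (A' m x).
Proof. by apply: trivIset_setIr; exact: trivIset_A. Qed.

Let grid_le m i : (i <= m.+1)%N -> grid T m i <= T.
Proof. by move=> im; rewrite -[leRHS](grid_max T m) grid_homo// ltW. Qed.

Let pr_A' m x i : (i <= m.+1)%N ->
  pr (A' m x i) = pr (A m x i) * pr [set w | 0 <= B T w - B (grid T m i) w].
Proof.
move=> im; apply: EFin_inj; rewrite EFinM -!prE//; last exact: measurable_incr_ge.
rewrite /A'; have <- : [set w | `[0, +oo[%classic (B T w - B (grid T m i) w)] =
    [set w | 0 <= B T w - B (grid T m i) w].
  by apply/seteqP; split => w /=; rewrite in_itv /= andbT.
have [_ ind _ _] := hB.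
apply: (@increments_past_independent _ _ R P (fun s w => B s w) (grid T m)
  i T `[0, +oo[%classic (A m x i)) => //.
- by rewrite grid0.
- by apply: grid_homo; exact: ltW.
- exact: grid_le.
- by apply: measurable_first_entrance => w; rewrite grid0 brownian0.
Qed.

(* After the first entrance above [x], the remaining increment is nonnegative
   with probability at least 1/2. *)
Lemma levy_upper m x : pr (grid_hit m x) <= 2 * pr [set w | x <= B T w].
Proof.
rewrite grid_hitE pr_bigcup// mulrC -ler_pdivrMr// mulr_suml.
apply: (@le_trans _ _ (pr (\bigcup_(i in `I_m.+2) A' m x i))).
  rewrite pr_bigcup//; apply: ler_sum => -[i im] _ /=.
  rewrite pr_A'//; apply: ler_wpM2l; first exact: pr_ge0.
  (* The last grid point is T: the remaining increment is 0 and its event is certain. *)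
  have [->|im1] := eqVneq i m.+1.
    rewrite grid_max (_ : [set w | _] = setT).
      by rewrite /rprob probability_setT /=; lra.
    by apply/seteqP; split => w //= _; rewrite subrr.
  rewrite brownian_increment_half ?grid_ge0 ?(ltW T0)//.
  by rewrite -[ltRHS](grid_max T m) /grid ltr_pM2r ?invr_gt0// ltr_pM2r// ltr_nat ltn_neqAle im1.
apply: pr_mono.
- by apply: bigcup_measurable => i _; exact: measurable_A'.
- exact: measurable_ge.
- by move=> w [i _ [[_ h1] /= h2]]; lra.
Qed.

(* Outside [grid_jump m e], the first entrance overshoots [x] by less than [e]. *)
Lemma levy_lower m x e : 0 < x -> 0 < e ->
  2 * pr [set w | x + e <= B T w] <= pr (grid_hit m x) + 2 * pr (grid_jump m e).
Proof.
move=> x0 e0.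
have mU : measurable (\bigcup_(i in `I_m.+1) A' m x i).
  by apply: bigcup_measurable => i _; exact: measurable_A'.
have sub : [set w | x + e <= B T w] `<=`
    grid_jump m e `|` \bigcup_(i in `I_m.+1) A' m x i.
  move=> w /= xeT; have [jmp|noj] := pselect (grid_jump m e w); [by left|right].
  have jump i : (i <= m)%N -> B (grid T m i.+1) w < B (grid T m i) w + e.
    move=> im; rewrite ltNge; apply/negP => h; apply: noj.
    by exists i => //=; lra.
  have [|j jm [jlt jx]] := @A_exists m x m.+1 w; first by rewrite grid_max; lra.
  have jxe : B (grid T m j) w < x + e.
    case: j jm jlt jx => [|j] jm jlt jx.
      by move: jx; rewrite grid0 brownian0; lra.
    by have := jump j jm; have := jlt j (leqnn _); lra.
  exists j; last by split => //=; lra.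
  (* The entrance index is not the last one, since B(T) >= x + e while the entrance value is below x
     + e. Every index left thus has the exact factor 1/2. *)
  rewrite /= ltn_neqAle jm andbT; apply/eqP => jE.
  by move: jxe; rewrite jE grid_max; lra.
have h1 := pr_mono P (measurable_ge _ _) (measurableU _ _ (measurable_grid_jump m e) mU) sub.
have h2 := pr_setU P (measurable_grid_jump m e) mU.
have h3 : 2 * pr (\bigcup_(i in `I_m.+1) A' m x i) <= pr (grid_hit m x).
  rewrite grid_hitE !pr_bigcup// mulr_sumr [leRHS]big_ord_recr /=.
  rewrite -[leLHS]addr0; apply: lerD; last exact: pr_ge0.
  apply: ler_sum => -[i im] _ /=; rewrite pr_A'; last exact: ltnW.
  rewrite brownian_increment_half ?grid_ge0 ?(ltW T0)//; last first.
    by rewrite -[ltRHS](grid_max T m) /grid ltr_pM2r ?invr_gt0// ltr_pM2r// ltr_nat.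
  by rewrite mulrCA mulfV ?mulr1.
lra.
Qed.

Definition hit x : set Omega := [set w | exists r, [/\ 0 <= r, r <= T & x <= B r w]].

(** Replaces an uncountable union over times by countably many values of the path. Grid points may
    miss the level itself, hence the slack 1/(k + 1), which compactness removes. Both measurability
    and membership in the sigma-algebra of B come from this form. *)
Lemma hitE x : hit x =
  \bigcap_(k in [set: nat]) \bigcup_(m in [set: nat]) grid_hit m (x - k.+1%:R^-1).
Proof.
apply/seteqP; split => w /=.
  move=> h k _; have k0 : 0 < k.+1%:R^-1 :> R by rewrite invr_gt0.
  have [m _ /(_ m (leqnn m)) [i im hi]] := path_reaches_near (@brownian_path w) T0 k0 h.
  by exists m => //; exists i.
move=> h; apply: (path_reachesP (@brownian_path w) (ltW T0)) => e e0.
have /(_ _ e0) : forall e : R, 0 < e -> \forall k \near \oo, k.+1%:R^-1 < e.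
  by move=> e' e'0; have /cvgr_lt := @cvg_harmonic R; apply.
move=> [k _ /(_ k (leqnn k)) /= ke].
have [m _ [i im hi]] := h k I.
exists (grid T m i); split; [exact: grid_ge0 (ltW T0)|exact: grid_le|].
by apply: le_trans hi; rewrite lerD2l lerN2 ltW.
Qed.

Lemma measurable_hit x : measurable (hit x).
Proof.
rewrite hitE; apply: bigcapT_measurable => k; apply: bigcupT_measurable => m.
exact: measurable_grid_hit.
Qed.

(* The density of [B T] is bounded by its peak. *)
Lemma brownian_level_continuous x e : 0 < e ->
  pr [set w | x <= B T w] <=
  pr [set w | x + e <= B T w] + normal_peak (Num.sqrt T) * e.
Proof.
move=> e0.
have mI : measurable [set w | `[x, x + e[%classic (B T w)] by exact: brownian_measurable.
have h1 : pr [set w | x <= B T w] <=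
    pr ([set w | x + e <= B T w] `|` [set w | `[x, x + e[%classic (B T w)]).
  apply: pr_mono; [exact: measurable_ge|apply: measurableU => //; exact: measurable_ge|].
  move=> w /= xB; have [h|h] := leP (x + e) (B T w); [by left|right].
  by rewrite in_itv /= xB.
apply: le_trans h1 _; apply: le_trans (pr_setU _ (measurable_ge _ _) mI) _.
rewrite lerD2l -lee_fin -prE// brownian_law//.
have -> : e = x + e - x by rewrite addrC addKr.
rewrite [X in `[x, X[%classic](_ : _ = x + e); last by rewrite [x + e]addrC addrK addrC.
by apply: normal_prob_itv_le; [rewrite sqrtr_eq0 -ltNge|lra].
Qed.

(** Each inequality is proved up to [e], from [levy_upper] at the lowered level a - e' and from
    [levy_lower] at a. Path continuity sends the grid error to 0, and [brownian_level_continuous]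
    pays for the shift of level. *)
Lemma reflection_principle : pr (hit a) = 2 * pr [set w | a <= B T w].
Proof.
set c := normal_peak (Num.sqrt T).
have c0 : 0 <= c by exact: normal_peak_ge0.
apply/eqP; rewrite eq_le; apply/andP; split.
  apply/ler_addgt0Pr => e e0.
  (* Gives c e' <= e/4, with c + 1 > 0 as a safe divisor; the level shift, counted twice, costs e/2
     and the grid error the other e/2. *)
  pose e' := e / (4 * (c + 1)).
  have e'0 : 0 < e' by rewrite divr_gt0// mulr_gt0//; lra.
  have e'E : c * e' <= e / 4.
    rewrite /e' invfM mulrA mulrA mulrC ler_pdivrMl; last by lra.
    by rewrite -mulrA ler_wpM2r; lra.
  have : pr (hit a `\` grid_hit m (a - e')) @[m --> \oo] --> 0.
    apply: pr_cvg0.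
      by move=> m; apply: measurableD; [exact: measurable_hit|exact: measurable_grid_hit].
    move=> w; have [h|h] := pselect (hit a w); last by apply: nearW => m [].
    have := path_reaches_near (@brownian_path w) T0 e'0 h.
    by apply: filterS => m [i im hi] [_]; apply; exists i.
  have e20 : 0 < e / 2 by rewrite divr_gt0.
  move=> /cvgr_lt /(_ _ e20) [m _ /(_ m (leqnn m)) /= hm].
  have h1 : pr (hit a) <= pr (grid_hit m (a - e') `|` (hit a `\` grid_hit m (a - e'))).
    apply: pr_mono; first exact: measurable_hit.
      apply: measurableU; first exact: measurable_grid_hit.
      by apply: measurableD; [exact: measurable_hit|exact: measurable_grid_hit].
    by move=> w h; have [?|?] := pselect (grid_hit m (a - e') w); [left|right].
  have h2 := pr_setU P (measurable_grid_hit m (a - e'))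
    (measurableD (measurable_hit a) (measurable_grid_hit m (a - e'))).
  have h3 := levy_upper m (a - e').
  have := brownian_level_continuous (a - e') e'0; rewrite subrK -/c.
  lra.
apply/ler_addgt0Pr => e e0.
pose e' := e / (4 * (c + 1)).
have e'0 : 0 < e' by rewrite divr_gt0// mulr_gt0//; lra.
have e'E : c * e' <= e / 4.
  rewrite /e' invfM mulrA mulrA mulrC ler_pdivrMl; last by lra.
  by rewrite -mulrA ler_wpM2r; lra.
have : pr (grid_jump m e') @[m --> \oo] --> 0.
  apply: pr_cvg0; first by move=> m; exact: measurable_grid_jump.
  move=> w; have := path_increment_near (@brownian_path w) (ltW T0) e'0.
  by apply: filterS => m h [i /= im]; rewrite leNgt h.
have e40 : 0 < e / 4 by rewrite divr_gt0.
move=> /cvgr_lt /(_ _ e40) [m _ /(_ m (leqnn m)) /= hm].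
have h1 := levy_lower m a0 e'0.
have h2 : pr (grid_hit m a) <= pr (hit a).
  apply: pr_mono; [exact: measurable_grid_hit|exact: measurable_hit|].
  by move=> w [i im hi]; exists (grid T m i); split; [exact: grid_ge0 (ltW T0)|exact: grid_le|].
have := brownian_level_continuous a e'0; rewrite -/c.
lra.
Qed.

End reflection_principle.

(** * The law of the first-passage time *)

Section passage_law.
Context {d : measure_display} {Omega : measurableType d} {R : realType}
  {P : probability Omega R} (B : R -> {RV P >-> R}).
Hypothesis hB : standard_brownian_motion B.
Implicit Types (s a y : R).
Let mu : {measure set (measurableTypeR R) -> \bar R} := @lebesgue_measure R.

Lemma normal_peak_scale s : 0 < s -> normal_peak s = normal_peak 1 / s.
Proof.
move=> s0; rewrite /normal_peak expr1n mul1r -mulrnAr sqrtrM ?sqr_ge0//.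
by rewrite sqrtr_sqr gtr0_norm// invfM mulrC.
Qed.

(** Substitution z = a sqrt(s) y, which sends the endpoint a to 1/sqrt(s): the level moves into the
    kernel and the time stays only in the domain. *)
Lemma normal_prob_tail s a : 0 < s -> 0 < a ->
  normal_prob 0 (Num.sqrt s) `[a, +oo[%classic =
  (\int[mu]_(y in `[(Num.sqrt s)^-1%R, +oo[) (gauss_kernel a y)%:E)%E.
Proof.
move=> s0 a0; have rs0 : 0 < Num.sqrt s by rewrite sqrtr_gt0.
pose b := (Num.sqrt s)^-1; pose c := a * Num.sqrt s.
have c0 : 0 < c by rewrite mulr_gt0.
pose F y : R := c * y.
have Fb : F b = a by rewrite /F /c /b mulfK// gt_eqF.
have dF y : is_derive y 1 F c.
  by rewrite /F; apply: is_derive_eq; rewrite /GRing.scale /= ?mulr0 ?add0r mulr1.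
have F' : (F^`())%classic = cst c by apply/funext => y; rewrite derive1E derive_val.
rewrite /normal_prob -Fb increasing_ge0_integration_by_substitutiony; first last.
- by move=> x _; exact: normal_pdf_ge0.
- by apply: continuous_subspaceT; apply: continuous_normal_pdf; rewrite gt_eqF.
- by apply: (gt0_cvgMry c0); exact: cvg_id.
- split; first by move=> x _; have ? := dF x; exact: ex_derive.
  apply: cvg_at_right_filter; apply/differentiable_continuous/derivable1_diffP.
  by have ? := dF b; exact: ex_derive.
- by rewrite F'; exact: is_cvg_cst.
- by rewrite F'; exact: is_cvg_cst.
- by move=> x _; rewrite F'; exact: cst_continuous.
- by move=> x y _ _ xy; rewrite /F ltr_pM2l.
apply: eq_integral => y _; rewrite F' /= /GRing.mul /=; congr (_%:E).
rewrite Fb normal_pdfE ?gt_eqF// normal_peak_scale// /normal_fun subr0 sqr_sqrtr ?(ltW s0)//.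
have -> : - F y ^+ 2 / (s *+ 2) = - (a * y) ^+ 2 / 2.
  rewrite /F /c -mulr_natr !exprMn sqr_sqrtr ?(ltW s0)//.
  by field; rewrite gt_eqF.
by rewrite /gauss_kernel /c; field; rewrite gt_eqF.
Qed.

Lemma brownian_tail s a : 0 < s -> 0 < a ->
  P [set w | a <= B s w] =
  (\int[mu]_(y in `[(Num.sqrt s)^-1%R, +oo[) (gauss_kernel a y)%:E)%E.
Proof.
move=> s0 a0; rewrite -normal_prob_tail// -(brownian_law hB)//; congr (P _).
by apply/seteqP; split => w /=; rewrite in_itv /= andbT.
Qed.

(** The event {Z <= s} read through Z = y^-2; the condition 0 < y discards the negative root and the
    convention 0^-1 = 0. *)
Definition inv_sqr_le s : set R := [set y | 0 < y /\ y ^- 2 <= s].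

Lemma inv_sqr_leE s : 0 < s -> inv_sqr_le s = `[(Num.sqrt s)^-1%R, +oo[%classic.
Proof.
move=> s0; have rs0 : 0 < Num.sqrt s by rewrite sqrtr_gt0.
have E y : 0 < y -> (y ^- 2 <= s) = ((Num.sqrt s)^-1 <= y).
  move=> y0; rewrite -[in LHS](@sqr_sqrtr _ s) ?(ltW s0)// -exprVn.
  rewrite ler_pXn2r ?nnegrE ?(ltW rs0) ?invr_ge0 ?(ltW y0)//.
  by rewrite -[in RHS](invrK y) lef_pV2 ?posrE ?invr_gt0.
apply/seteqP; split => y /=; rewrite in_itv /= andbT.
  by move=> [y0]; rewrite E.
move=> h; have y0 : 0 < y by apply: lt_le_trans h; rewrite invr_gt0.
by split => //; rewrite E.
Qed.

Lemma inv_sqr_le0 : inv_sqr_le 0 = set0.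
Proof.
apply/seteqP; split => y //= [y0]; rewrite leNgt => /negP; apply.
by rewrite invr_gt0 exprn_gt0.
Qed.

Lemma measurable_inv_sqr_le s : 0 <= s -> measurable (inv_sqr_le s).
Proof.
rewrite le_eqVlt => /predU1P[<-|s0]; first by rewrite inv_sqr_le0; exact: measurable0.
by rewrite inv_sqr_leE//; exact: measurable_itv.
Qed.

Lemma hit0 a : 0 < a -> hit B 0 a = set0.
Proof.
move=> a0; apply/seteqP; split => w //= [r [r0 r1]].
have -> : r = 0 by apply/eqP; rewrite eq_le r0 r1.
by rewrite (brownian0 hB) leNgt a0.
Qed.

Lemma measurable_hit_ge0 s a : 0 <= s -> 0 < a -> measurable (hit B s a).
Proof.
rewrite le_eqVlt => /predU1P[<-|s0] a0; first by rewrite hit0; last exact: a0.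
exact: measurable_hit.
Qed.

Lemma hit_law s a : 0 <= s -> 0 < a ->
  P (hit B s a) = (2%:E * \int[mu]_(y in inv_sqr_le s) (gauss_kernel a y)%:E)%E.
Proof.
rewrite le_eqVlt => /predU1P[<-|s0] a0.
  by rewrite hit0// inv_sqr_le0 integral_set0 measure0 mule0.
rewrite inv_sqr_leE// -brownian_tail// prE; last exact: measurable_hit.
by rewrite reflection_principle// EFinM -prE//; exact: measurable_ge.
Qed.

Lemma hit_sub s s' a : s <= s' -> hit B s a `<=` hit B s' a.
Proof. by move=> ss w [r [r0 rs ar]]; exists r; split => //; exact: le_trans ss. Qed.

Lemma inv_sqr_le_sub s s' : s <= s' -> inv_sqr_le s `<=` inv_sqr_le s'.
Proof. by move=> ss y [y0 ys]; split => //; exact: le_trans ss. Qed.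

Lemma hit_interval_law s s' a : 0 <= s -> s <= s' -> 0 < a ->
  P (hit B s' a `\` hit B s a) =
  (2%:E * \int[mu]_(y in inv_sqr_le s' `\` inv_sqr_le s) (gauss_kernel a y)%:E)%E.
Proof.
move=> s0 ss a0; have s'0 := le_trans s0 ss.
have mh := measurable_hit_ge0 s0 a0; have mh' := measurable_hit_ge0 s'0 a0.
have md := measurable_inv_sqr_le s0; have md' := measurable_inv_sqr_le s'0.
have mK (D : set R) : measurable D -> measurable_fun D (fun y => (gauss_kernel a y)%:E).
  move=> mD; apply/measurable_EFinP/measurable_funTS.
  exact: continuous_measurable_fun (@continuous_gauss_kernel R a).
have K0 (D : set R) y : D y -> (0 <= (gauss_kernel a y)%:E)%E.
  by move=> _; rewrite lee_fin gauss_kernel_ge0.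
have split_int : (\int[mu]_(y in inv_sqr_le s') (gauss_kernel a y)%:E =
    \int[mu]_(y in inv_sqr_le s) (gauss_kernel a y)%:E +
    \int[mu]_(y in inv_sqr_le s' `\` inv_sqr_le s) (gauss_kernel a y)%:E)%E.
  rewrite -ge0_integral_setU//.
  - by rewrite setDUK//; exact: inv_sqr_le_sub.
  - exact: measurableD.
  - by apply: mK; apply: measurableU => //; exact: measurableD.
  - by apply: K0.
  - by rewrite /disj_set setDIK.
have hs : (P (hit B s' a) = P (hit B s a) + P (hit B s' a `\` hit B s a))%E.
  rewrite -measureU//.
  - by rewrite setDUK//; exact: hit_sub.
  - exact: measurableD.
  - by rewrite setDIK.
have := hs; rewrite !hit_law// split_int ge0_muleDr; first last.
- by apply: integral_ge0 => y; exact: K0.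
- by apply: integral_ge0 => y; exact: K0.
set x := (2%:E * _)%E => h.
(* Finite because it is a probability, which allows cancellation in the extended reals. *)
have xfin : x \is a fin_num by rewrite /x -hit_law// fin_num_measure.
rewrite !(addeC x) in h.
by rewrite -[LHS](addeK _ xfin) -h addeK.
Qed.

End passage_law.

(** * Subordination *)

Lemma natr_dist_lt1 {R : realType} (m n : nat) : `|m%:R - n%:R : R| < 1 -> n = m.
Proof.
rewrite ltr_norml; have [mn|nm|//] := ltngtP m n.
  by move: mn; rewrite -(ler_nat R) -natr1 => mn /andP[? ?]; exfalso; lra.
by move: nm; rewrite -(ler_nat R) -natr1 => nm /andP[? ?]; exfalso; lra.
Qed.

(** Both differences between [F m] and [G] are eventually empty at each point, so [pr_cvg0] applies
    to them. *)
Lemma pr_cvg {d : measure_display} {Omega : measurableType d} {R : realType}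
    {P : probability Omega R} (F : nat -> set Omega) (G : set Omega) :
  (forall m, measurable (F m)) ->
  (forall w, \forall m \near \oo, F m w <-> G w) ->
  rprob P (F m) @[m --> \oo] --> rprob P G.
Proof.
move=> mF FG.
(* Measurability of [G] is derived, as the lower limit of the [F m]; this serves the subordinated
   event, which is defined through a random time. *)
have GE : G = \bigcup_N \bigcap_(m in [set m | (N <= m)%N]) F m.
  apply/seteqP; split => w.
    move=> Gw; have [N _ HN] := FG w; exists N => // m Nm; exact: (HN m Nm).2.
  move=> [N _ HN]; have [N' _ HN'] := FG w.
  apply: (HN' (maxn N N') (leq_maxr _ _)).1; apply: HN; exact: leq_maxl.
have mG : measurable G.
  rewrite GE; apply: bigcupT_measurable => N; exact: bigcap_measurableType.
have h1 : rprob P (F m `\` G) @[m --> \oo] --> 0.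
  apply: pr_cvg0; first by move=> m; exact: measurableD.
  by move=> w; apply: filterS (FG w) => m FGm [/FGm].
have h2 : rprob P (G `\` F m) @[m --> \oo] --> 0.
  apply: pr_cvg0; first by move=> m; exact: measurableD.
  by move=> w; apply: filterS (FG w) => m FGm [/FGm].
have le1 m : rprob P (F m) <= rprob P G + rprob P (F m `\` G).
  apply: le_trans (pr_setU _ mG (measurableD (mF m) mG)); apply: pr_mono => //.
    by apply: measurableU => //; exact: measurableD.
  by move=> w Fw; have [?|?] := pselect (G w); [left|right].
have le2 m : rprob P G <= rprob P (F m) + rprob P (G `\` F m).
  apply: le_trans (pr_setU _ (mF m) (measurableD mG (mF m))); apply: pr_mono => //.
    by apply: measurableU => //; exact: measurableD.
  by move=> w Fw; have [?|?] := pselect (F m w); [left|right].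
apply/subr_cvg0/norm_cvg0P.
apply: (@squeeze_cvgr _ _ _ _ (cst 0)
  (fun m => rprob P (F m `\` G) + rprob P (G `\` F m))).
- apply: nearW => m; rewrite normr_ge0 /= ler_norml.
  have := le1 m; have := le2 m; have := pr_ge0 P (F m `\` G); have := pr_ge0 P (G `\` F m).
  by move=> *; apply/andP; split; lra.
- exact: cvg_cst.
- by rewrite -[X in _ --> X](addr0 0); apply: cvgD.
Qed.

Section subordination.
Context {d : measure_display} {Omega : measurableType d} {R : realType}
  {P : probability Omega R} (k : nat) (lambda : nat -> R)
  (M : R -> {RV P >-> nat}) (B : R -> {RV P >-> R}).
Hypothesis hM : generalized_counting_process k lambda M.
Hypothesis hB : standard_brownian_motion B.
Hypothesis hMB : independent_processes P M B.
Variable a : R.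
Hypothesis a0 : 0 < a.
Implicit Types (m i n : nat) (s y : R).
Let mu : {measure set (measurableTypeR R) -> \bar R} := @lebesgue_measure R.

(** Unlike [grid], it runs over the whole half-line, since the passage time is unbounded. *)
Definition mesh m i : R := i%:R / m.+1%:R.

Lemma mesh_ge0 m i : 0 <= mesh m i.
Proof. by rewrite divr_ge0. Qed.

Lemma mesh_homo m : {homo mesh m : i j / (i <= j)%N >-> i <= j}.
Proof. by move=> i j ij; rewrite /mesh ler_pM2r ?invr_gt0// ler_nat. Qed.

Lemma exists_cell m s : 0 < s -> exists i, mesh m i < s /\ s <= mesh m i.+1.
Proof.
move=> s0.
have ex : exists i, s <= mesh m i.
  exists (Num.truncn (s * m.+1%:R)).+1; rewrite ler_pdivlMr//.
  have x0 : 0 <= s * m.+1%:R by rewrite mulr_ge0// ltW.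
  by have /andP[_ /ltW] := truncn_itv x0.
have [[|i] hi imin] := ex_minnP ex.
  by move: hi; rewrite /mesh mul0r leNgt s0.
exists i; split => //; rewrite ltNge; apply/negP => /imin; by rewrite ltnn.
Qed.

Lemma cell_unique m s i j : mesh m i < s -> s <= mesh m i.+1 ->
  mesh m j < s -> s <= mesh m j.+1 -> i = j.
Proof.
move=> i1 i2 j1 j2; have [ij|ij|//] := ltngtP i j.
  by have := lt_le_trans j1 i2; rewrite ltNge (mesh_homo m ij).
by have := lt_le_trans i1 j2; rewrite ltNge (mesh_homo m ij).
Qed.

Definition passage_cell m i : set Omega :=
  hit B (mesh m i.+1) a `\` hit B (mesh m i) a.

Definition inv_sqr_cell m i : set R :=
  inv_sqr_le (mesh m i.+1) `\` inv_sqr_le (mesh m i).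

Lemma measurable_passage_cell m i : measurable (passage_cell m i).
Proof.
by apply: measurableD; apply: measurable_hit_ge0 => //; exact: mesh_ge0.
Qed.

Lemma measurable_inv_sqr_cell m i : measurable (inv_sqr_cell m i).
Proof.
by apply: measurableD; apply: measurable_inv_sqr_le => //; exact: mesh_ge0.
Qed.

Lemma trivIset_diff T (F : nat -> set T) :
  (forall i j, (i <= j)%N -> F i `<=` F j) ->
  trivIset setT (fun i => F i.+1 `\` F i).
Proof.
move=> FF; apply/trivIsetP => i j _ _; rewrite neq_ltn => /orP[] ij;
  apply/seteqP; split => w //= [[h1 h2] [h3 h4]].
  by apply: h4; exact: FF h1.
by apply: h2; exact: FF h3.
Qed.

Lemma trivIset_passage_cell m : trivIset setT (passage_cell m).
Proof. by apply: (@trivIset_diff _ (fun i => hit B (mesh m i) a)) => i j ij; apply: hit_sub; exact: mesh_homo. Qed.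

Lemma trivIset_inv_sqr_cell m : trivIset setT (inv_sqr_cell m).
Proof.
apply: (@trivIset_diff _ (fun i => inv_sqr_le (mesh m i))) => i j ij.
by apply: inv_sqr_le_sub; exact: mesh_homo.
Qed.

Lemma inv_sqr_cellP m i y : inv_sqr_cell m i y <->
  0 < y /\ mesh m i < y ^- 2 /\ y ^- 2 <= mesh m i.+1.
Proof.
split=> [[[y0 h1] h2]|[y0 [h1 h2]]].
  by split => //; split => //; rewrite ltNge; apply/negP => h; apply: h2.
by split => // -[_]; rewrite leNgt h1.
Qed.

Lemma bigcup_inv_sqr_cell m :
  \bigcup_i inv_sqr_cell m i = `]0, +oo[%classic.
Proof.
apply/seteqP; split => y /=; rewrite in_itv /= andbT.
  by move=> [i _ /inv_sqr_cellP[]].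
move=> y0; have [|i [h1 h2]] := @exists_cell m (y ^- 2).
  by rewrite invr_gt0 exprn_gt0.
by exists i => //; apply/inv_sqr_cellP.
Qed.

(** Independence of M and B concerns the sigma-algebras they generate, so measurability in [Omega]
    is not enough; the countable description [hitE] supplies membership. *)
Lemma process_hit s : 0 <= s -> process_sigma_algebra B (hit B s a).
Proof.
rewrite /process_sigma_algebra; set G := [set E | _].
pose T := g_sigma_algebraType G.
rewrite le_eqVlt => /predU1P[<-|s0].
  by rewrite (hit0 hB a0); exact: (@measurable0 _ T).
rewrite (hitE hB s0).
apply: (@bigcapT_measurable _ T) => j; apply: (@bigcupT_measurable _ T) => m.
apply: (@bigcup_measurable _ T) => i _; apply: sub_sigma_algebra.
exists (grid s m i), `[a - j.+1%:R^-1, +oo[%classic; split => //.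
- exact: grid_ge0 (ltW s0).
- by apply/seteqP; split => w /=; rewrite in_itv /= andbT.
Qed.

Lemma process_passage_cell m i : process_sigma_algebra B (passage_cell m i).
Proof.
rewrite /process_sigma_algebra; set G := [set E | _].
by apply: (@measurableD _ (g_sigma_algebraType G)); apply: process_hit; exact: mesh_ge0.
Qed.

Lemma passage_cell_independent m i n s : 0 <= s ->
  P (passage_cell m i `&` [set w | M s w = n]) =
  ((marginal M n s)%:E * P (passage_cell m i))%E.
Proof.
move=> s0; rewrite setIC hMB; first by rewrite marginalE.
  apply: sub_sigma_algebra; exists s, [set n]; split => //.
exact: process_passage_cell.
Qed.

(* [{M(Z) = n}] with the passage time [Z] rounded up to the next mesh point, so
   that the right-continuity of [M] applies. *)
Definition approx_event m n : set Omega :=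
  \bigcup_i (passage_cell m i `&` [set w | M (mesh m i.+1) w = n]).

(** For s > 0 a cell exists by [exists_cell], so the default 0 of [xget] is not reached. *)
Definition cell_index m s : nat :=
  xget 0%N [set i | mesh m i < s /\ s <= mesh m i.+1].

Definition approx_marginal m n s : R := marginal M n (mesh m (cell_index m s).+1).

Lemma cell_indexP m s : 0 < s ->
  mesh m (cell_index m s) < s /\ s <= mesh m (cell_index m s).+1.
Proof.
move=> s0; rewrite /cell_index; case: xgetP => [j -> //|none].
by have [i hi] := exists_cell m s0; have := none i.
Qed.

Lemma approx_marginal_cell m n i y : inv_sqr_cell m i y ->
  approx_marginal m n (y ^- 2) = marginal M n (mesh m i.+1).
Proof.
move=> /inv_sqr_cellP[y0 [h1 h2]].
have y20 : 0 < y ^- 2 by rewrite invr_gt0 exprn_gt0.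
have [h3 h4] := cell_indexP m y20.
by rewrite /approx_marginal (cell_unique h3 h4 h1 h2).
Qed.

Lemma measurable_approx_marginal m n :
  measurable_fun (`]0, +oo[%classic : set R) (fun y : R => approx_marginal m n (y ^- 2)).
Proof.
rewrite -(bigcup_inv_sqr_cell m); apply/measurable_fun_bigcup.
  exact: measurable_inv_sqr_cell.
move=> i; apply: (@eq_measurable_fun _ _ _ _ _ (cst (marginal M n (mesh m i.+1)))) => //.
by move=> y; rewrite inE => /approx_marginal_cell ->.
Qed.

(** On each cell, independence factors the probability and [hit_interval_law] turns the cell of Z
    into a cell in y, where [approx_marginal] is constant. These cells partition ]0, +oo[. *)
Lemma approx_event_law m n : P (approx_event m n) =
  (2%:E * \int[mu]_(y in `]0%R, +oo[) (approx_marginal m n (y ^- 2)%R * gauss_kernel a y)%:E)%E.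
Proof.
have mE i : measurable (passage_cell m i `&` [set w | M (mesh m i.+1) w = n]).
  by apply: measurableI; [exact: measurable_passage_cell|exact: measurable_marginal].
have nonneg y : (0 <= (approx_marginal m n (y ^- 2) * gauss_kernel a y)%:E)%E.
  by rewrite lee_fin mulr_ge0 ?marginal_ge0 ?gauss_kernel_ge0.
have mK (D : set R) : measurable_fun D (gauss_kernel a).
  by apply: measurable_funTS; exact: continuous_measurable_fun (@continuous_gauss_kernel R a).
rewrite measure_bigcup//; last by apply: trivIset_setIr; exact: trivIset_passage_cell.
rewrite -(bigcup_inv_sqr_cell m) ge0_integral_bigcup//; first last.
- exact: trivIset_inv_sqr_cell.
- apply/measurable_EFinP; rewrite bigcup_inv_sqr_cell.
  apply: measurable_funM; last exact: mK. exact: (@measurable_approx_marginal m n).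
- exact: measurable_inv_sqr_cell.
rewrite -nneseriesZl; last by move=> i _; exact: integral_ge0.
rewrite (@eq_eseriesl _ _ xpredT); last by move=> i; rewrite in_setT.
apply: eq_eseriesr => i _.
transitivity ((marginal M n (mesh m i.+1))%:E * P (passage_cell m i))%E.
  by apply: passage_cell_independent; exact: mesh_ge0.
rewrite /passage_cell (hit_interval_law hB) ?mesh_ge0 ?mesh_homo//.
rewrite muleCA; congr (_ * _)%E.
rewrite -ge0_integralZl_EFin ?marginal_ge0//.
- by apply: eq_integral => y; rewrite inE => yc; rewrite (approx_marginal_cell n yc) EFinM.
- exact: measurable_inv_sqr_cell.
- by move=> y _; rewrite lee_fin gauss_kernel_ge0.
- by apply/measurable_EFinP; exact: mK.
Qed.


Definition never_hit : set Omega := \bigcap_N ~` hit B N%:R a.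

Lemma measurable_never_hit : measurable never_hit.
Proof.
by apply: bigcapT_measurable => N; apply: measurableC; apply: measurable_hit_ge0.
Qed.

(** By reflection, the level is missed up to time N with probability 1 - 2 P(B(N) >= a), which is at
    most twice the mass that B(N) puts on [0, a[, and its density flattens as N grows. *)
Lemma never_hit_null : rprob P never_hit = 0.
Proof.
apply/eqP; rewrite eq_le pr_ge0 andbT; apply/ler_addgt0Pr => e e0; rewrite add0r.
pose c := normal_peak (1 : R).
have c0 : 0 <= c by exact: normal_peak_ge0.
(* The bound on the missed mass is 2 c a / sqrt(N), which is at most [e] once sqrt(N) >= X. *)
pose X := 2 * c * a / e.
have X0 : 0 <= X by rewrite divr_ge0 ?(ltW e0)// !mulr_ge0// ltW.
pose N := (Num.truncn (X ^+ 2)).+1.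
have N0 : 0 < N%:R :> R by rewrite ltr0n.
have XN : X <= Num.sqrt N%:R.
  rewrite -[X]ger0_norm// -sqrtr_sqr ler_wsqrtr//.
  by have /andP[_ /ltW] := truncn_itv (sqr_ge0 X).
have h1 := brownian_level_continuous hB N0 0 a0.
rewrite add0r in h1.
have h2 : rprob P [set w | 0 <= B N%:R w] = 2^-1.
  rewrite -(brownian_increment_half hB (lexx 0) N0)//; congr (rprob P _).
  by apply/seteqP; split => w /=; rewrite (brownian0 hB) subr0.
have h3 := reflection_principle hB N0 a0.
have mh := measurable_hit hB N0 a.
have h4 : rprob P never_hit <= rprob P (~` hit B N%:R a).
  by apply: pr_mono; [exact: measurable_never_hit|exact: measurableC|move=> w; exact].
have h5 : rprob P (~` hit B N%:R a) = 1 - rprob P (hit B N%:R a).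
  by apply: EFin_inj; rewrite EFinB -!prE//; [exact: probability_setC|exact: measurableC].
have sN : 0 < Num.sqrt (N%:R : R) by rewrite sqrtr_gt0.
have h6 : 2 * (normal_peak (Num.sqrt N%:R) * a) <= e.
  rewrite normal_peak_scale// -/c.
  have -> : 2 * (c / Num.sqrt N%:R * a) = 2 * c * a / Num.sqrt N%:R.
    by rewrite !mulrA -[2 * c / _ * a]mulrA [_^-1 * a]mulrC mulrA.
  by rewrite ler_pdivrMr// -ler_pdivrMl// mulrC.
move: h1 h2 h3 h4 h5 h6; move: (normal_peak _ * a) => z; lra.
Qed.

Lemma hit_leP w s : 0 <= s ->
  hit B s a w <-> (first_passage_time (fun r w => B r w) a w <= s%:E)%E.
Proof.
move=> s0; rewrite /hit /= /first_passage_time.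
by rewrite first_passage_leP//; [exact: brownian_path|exact: brownian0].
Qed.

Lemma never_hitP w : never_hit w \/
  exists2 z : R, 0 < z & first_passage_time (fun r w => B r w) a w = z%:E.
Proof.
have [h|h] := pselect (never_hit w); [by left|right].
have [N hN] : exists N : nat, hit B N%:R a w.
  by apply: contrapT => hN; apply: h => N _ hNw; apply: hN; exists N.
move: hN => /(hit_leP w (ler0n _ _)) ZN.
have Z0 : (0 < first_passage_time (fun r w => B r w) a w)%E.
  rewrite ltNge; apply/negP => Z0.
  by have := (hit_leP w (lexx 0)).2 Z0; rewrite hit0.
move: Z0 ZN; case: first_passage_time => [z| |]//; rewrite lte_fin => z0 _.
by exists z.
Qed.

Lemma passage_cellP m i w z :
  first_passage_time (fun r w => B r w) a w = z%:E ->
  passage_cell m i w <-> mesh m i < z /\ z <= mesh m i.+1.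
Proof.
move=> Zz; split.
  move=> [] /hit_leP; rewrite Zz lee_fin => /(_ (mesh_ge0 _ _)) h1 h2.
  by split => //; rewrite ltNge; apply/negP => h; apply: h2; apply/hit_leP;
    rewrite ?mesh_ge0// Zz lee_fin.
move=> [h1 h2]; split; first by apply/hit_leP; rewrite ?mesh_ge0// Zz lee_fin.
by move=> /hit_leP; rewrite Zz lee_fin => /(_ (mesh_ge0 _ _)); rewrite leNgt h1.
Qed.

Lemma approx_event_near n w z : 0 < z ->
  first_passage_time (fun r w => B r w) a w = z%:E ->
  \forall m \near \oo, approx_event m n w <-> M z w = n.
Proof.
move=> z0 Zz.
have [[_ _ _ _ /(_ w)[rc _]] _] := hM.
(* Integers at distance less than 1 coincide, so M is constant just after z; rounding up keeps the
   mesh point on that side. *)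
have := rc z (ltW z0) => /cvgrPdist_lt /(_ 1 ltr01) [delta /= d0 Hd].
near=> m.
have hm : 1 / m.+1%:R < delta by near: m; exact: mesh_near.
have [i [h1 h2]] := exists_cell m z0.
have Mz : M (mesh m i.+1) w = M z w.
  move: h2; rewrite le_eqVlt => /predU1P[<-//|h2].
  have := Hd (mesh m i.+1); rewrite /= => /(_ _ h2).
  have -> : `|z - mesh m i.+1| < delta.
    have e1 : mesh m i.+1 = mesh m i + 1 / m.+1%:R by rewrite /mesh -natr1 mulrDl.
    move: h1 h2 hm; rewrite e1; move: (mesh m i) (1 / _) => u v ? ? ?.
    by rewrite ltr_norml; apply/andP; split; lra.
  by move=> /(_ isT)/natr_dist_lt1.
split=> [[j _ [/(passage_cellP m j Zz)[h3 h4] /= <-]]|Mn].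
  by rewrite -Mz (cell_unique h1 h2 h3 h4).
by exists i => //; split; [apply/(passage_cellP m i Zz)|rewrite /= Mz].
Unshelve. all: by end_near. Qed.

Definition subordinated_event n : set Omega :=
  [set w | first_passage_subordinated (fun s w => M s w) (fun s w => B s w) a w = n].

(* When the level is never reached, [fine] turns the passage time +oo into 0,
   and [M 0 = 0]. *)
Definition approx_event' m n : set Omega :=
  approx_event m n `|` (if n == 0%N then never_hit else set0).

Lemma approx_event'_near n w :
  \forall m \near \oo, approx_event' m n w <-> subordinated_event n w.
Proof.
have [nh|[z z0 Zz]] := never_hitP w; last first.
  have nnh : ~ never_hit w.
    have zN : z <= (Num.truncn z).+1%:R.
      by have /andP[_ /ltW] := truncn_itv (ltW z0).
    move=> /(_ (Num.truncn z).+1 I); apply; apply/hit_leP => //.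
    by rewrite Zz lee_fin.
  apply: filterS (approx_event_near n z0 Zz) => m hm.
  rewrite /subordinated_event /= /first_passage_subordinated Zz /= -hm.
  by split=> [[//|]|]; [case: ifP|left].
have Zoo : first_passage_time (fun r w => B r w) a w = +oo%E.
  apply/eqP; rewrite -leye_eq leNgt; apply/negP => Zlt.
  have : (exists N : nat, (first_passage_time (fun r w => B r w) a w <= N%:R%:E)%E).
    move: Zlt; case: first_passage_time => [z| |]//= _; last by exists 0%N; rewrite leNye.
    exists (Num.truncn `|z|).+1; rewrite lee_fin; apply: le_trans (ler_norm _) _.
    by have /andP[_ /ltW] := truncn_itv (normr_ge0 z).
  by move=> [N] /(hit_leP w (ler0n _ _)); exact: nh.
apply: nearW => m; rewrite /subordinated_event /= /first_passage_subordinated Zoo /=.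
rewrite (gcp_start hM); split=> [[[i _ [[h _] _]]|]|<-]; last by right.
  move: h => /(hit_leP w (mesh_ge0 _ _)); by rewrite Zoo.
by case: ifP => // /eqP.
Qed.

Lemma measurable_approx_event m n : measurable (approx_event m n).
Proof.
apply: bigcupT_measurable => i; apply: measurableI.
  exact: measurable_passage_cell.
exact: measurable_marginal.
Qed.

Lemma measurable_never_hit_if n :
  measurable (if n == 0%N then never_hit else set0).
Proof. by case: ifP => _ //; exact: measurable_never_hit. Qed.

Lemma approx_event'_prob m n : rprob P (approx_event' m n) = rprob P (approx_event m n).
Proof.
have mN := measurable_never_hit_if n; have mA := measurable_approx_event m n.
apply/eqP; rewrite eq_le; apply/andP; split.
  apply: le_trans (pr_setU P mA mN) _; rewrite gerDl.
  by case: ifP => _; rewrite ?never_hit_null// /rprob measure0.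
by apply: (pr_mono P mA (measurableU _ _ mA mN)); exact: subsetUl.
Qed.

Lemma approx_event_cvg n :
  rprob P (approx_event m n) @[m --> \oo] --> rprob P (subordinated_event n).
Proof.
under eq_fun do rewrite -approx_event'_prob.
apply: (pr_cvg (F := fun m => approx_event' m n)).
  move=> m; apply: measurableU; first exact: measurable_approx_event.
  exact: measurable_never_hit_if.
exact: approx_event'_near.
Qed.

Lemma integrable_kernel_bounded (f : R -> R) :
  measurable_fun (`]0, +oo[%classic : set R) f ->
  (forall y, 0 < y -> `|f y| <= 1) ->
  mu.-integrable `]0, +oo[%classic (fun y => (f y * gauss_kernel a y)%:E).
Proof.
move=> mf f1.
have a20 : 0 < a / 2 by rewrite divr_gt0.
have a2a : a / 2 < a by rewrite ltr_pdivrMr// ltr_pMr// ltr1n.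
apply: (@integrable_bounded_kernel _ _ _ 1 (normal_peak 1 * a) (a / 2)) => //.
- by move=> y /=; rewrite in_itv /= andbT; exact: f1.
- by apply: measurable_funTS; exact: continuous_measurable_fun (@continuous_gauss_kernel R a).
- by move=> y _; have [] := gauss_kernels_bound y a20 a2a.
Qed.

Lemma measurable_marginal_inv_sqr n :
  measurable_fun (`]0, +oo[%classic : set R) (fun y : R => marginal M n (y ^- 2)).
Proof.
apply: open_continuous_measurable_fun; first exact: interval_open.
move=> y; rewrite inE /= in_itv /= andbT => y0.
apply: (@continuous_comp _ _ _ (fun x : R => x ^- 2) (marginal M n)).
  apply: cvgV; first by rewrite gt_eqF ?exprn_gt0.
  exact: exprn_continuous.
by apply: (continuous_marginal hM); rewrite invr_gt0 exprn_gt0.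
Qed.

Lemma approx_marginal_cvg n s : 0 < s ->
  approx_marginal m n s @[m --> \oo] --> marginal M n s.
Proof.
move=> s0; apply/cvgrPdist_le => e e0.
have /cvgrPdist_le /(_ e e0) [delta /= d0 Hd] := continuous_marginal hM (n := n) s0.
near=> m.
have hm : 1 / m.+1%:R < delta by near: m; exact: mesh_near.
have [h1 h2] := cell_indexP m s0.
apply: Hd => /=; move: h1 h2 hm.
have -> : mesh m (cell_index m s).+1 = mesh m (cell_index m s) + 1 / m.+1%:R.
  by rewrite /mesh -natr1 mulrDl.
move: (mesh m _) (1 / _) => u v ? ? ?.
by rewrite ltr_norml; apply/andP; split; lra.
Unshelve. all: by end_near. Qed.

(** The probability of [approx_event m n] has two limits in m: the probability of the subordinated
    event, and, by dominated convergence with the kernel as majorant, the integral with the exact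
    marginal. They coincide. *)
Lemma subordinated_prob n : rprob P (subordinated_event n) =
  2 * \int[mu]_(y in `]0, +oo[) (marginal M n (y ^- 2) * gauss_kernel a y).
Proof.
pose D : set R := `]0, +oo[%classic.
have mD : measurable D by exact: measurable_itv.
have int_approx m : mu.-integrable D
    (fun y => (approx_marginal m n (y ^- 2) * gauss_kernel a y)%:E).
  apply: integrable_kernel_bounded; first exact: (@measurable_approx_marginal m n).
  by move=> y _; exact: normr_marginal.
have int_lim : mu.-integrable D
    (fun y => (marginal M n (y ^- 2) * gauss_kernel a y)%:E).
  apply: integrable_kernel_bounded; first exact: (@measurable_marginal_inv_sqr n).
  by move=> y _; exact: normr_marginal.
have int_K : mu.-integrable D (fun y => (1 * gauss_kernel a y)%:E).
  by apply: (@integrable_kernel_bounded (cst 1)) => // y _; rewrite /= normr1.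
have lim : (\int[mu]_(y in D) (approx_marginal m n (y ^- 2) * gauss_kernel a y)%:E)%E
    @[m --> \oo] -->
    (\int[mu]_(y in D) (marginal M n (y ^- 2) * gauss_kernel a y)%:E)%E.
  apply: (@dominated_cvg _ _ _ mu D mD
    (fun m y => (approx_marginal m n (y ^- 2) * gauss_kernel a y)%:E)
    (fun y => (marginal M n (y ^- 2) * gauss_kernel a y)%:E)
    (fun y => (1 * gauss_kernel a y)%:E)) => //.
  - by move=> m; case/integrableP: (int_approx m).
  - move=> y; rewrite /D /= in_itv /= andbT => y0.
    apply: cvg_EFin; first exact: nearW.
    apply: cvgMl; apply: approx_marginal_cvg.
    by rewrite invr_gt0 exprn_gt0.
  - move=> m y _; rewrite lee_fin normrM ler_pM// ?normr_marginal//.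
    by rewrite ger0_norm// gauss_kernel_ge0.
have lim1 : rprob P (approx_event m n) @[m --> \oo] -->
    2 * \int[mu]_(y in D) (marginal M n (y ^- 2) * gauss_kernel a y).
  have -> : (fun m => rprob P (approx_event m n)) = (fun m =>
      2 * \int[mu]_(y in D) (approx_marginal m n (y ^- 2) * gauss_kernel a y)).
    apply/funext => m; rewrite /rprob approx_event_law fineM//.
    exact: integrable_fin_num (int_approx m).
  apply: cvgMr; apply: fine_cvg.
  by rewrite fineK//; exact: integrable_fin_num int_lim.
rewrite -(cvg_lim _ (@approx_event_cvg n))//; exact: cvg_lim lim1.
Qed.

End subordination.

(** * The differential equations *)

Lemma Rintegral_linear_combination {d : measure_display} {T : measurableType d}
    {R : realType} {mu : {measure set T -> \bar R}} (D : set T) (n : nat)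
    (c : nat -> R) (f : nat -> T -> R) :
  measurable D -> (forall i, mu.-integrable D (EFin \o f i)) ->
  \int[mu]_(x in D) (\sum_(i < n) c i * f i x) =
  \sum_(i < n) c i * \int[mu]_(x in D) f i x.
Proof.
move=> mD intf.
have intcf i : mu.-integrable D (fun x => (c i * f i x)%:E).
  rewrite (_ : (fun x => _) = (fun x => (c i)%:E * (EFin \o f i) x)%E)//.
  exact: integrableZl.
suff [] : mu.-integrable D (fun x => (\sum_(i < n) c i * f i x)%:E) /\
  \int[mu]_(x in D) (\sum_(i < n) c i * f i x) =
  \sum_(i < n) c i * \int[mu]_(x in D) f i x by [].
elim: n => [|n [IH1 IH2]].
  split; first by under eq_fun do rewrite big_ord0; exact: integrable0.
  under eq_Rintegral do rewrite big_ord0.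
  by rewrite big_ord0 /Rintegral integral0.
split.
  under eq_fun do rewrite big_ord_recr /= EFinD.
  exact: integrableD.
under eq_Rintegral do rewrite big_ord_recr /=.
rewrite RintegralD; [|exact: mD|exact: IH1|exact: intcf].
rewrite [RHS]big_ord_recr /=.
by congr (_ + _); [exact: IH2|rewrite RintegralZl].
Qed.

Theorem theorem4p1 (R : realType) (d : measure_display)
    (Omega : measurableType d) (P : probability Omega R)
    (k : nat) (hk : (1 <= k)%N)
    (lambda : nat -> R)
    (hlambda : forall j : nat, (1 <= j <= k)%N -> 0 < lambda j)
    (M : R -> {RV P >-> nat})
    (hM : generalized_counting_process k lambda M)
    (B : R -> {RV P >-> R})
    (hB : standard_brownian_motion B)
    (hMB : independent_processes P M B) :
  let p := state_prob P (first_passage_subordinated M B) in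
  forall (n : nat) (t : R), 0 < t ->
    [/\ derivable (p n) t 1,
        derivable (p n)^`()%classic t 1 &
        (p n)^`(2)%classic t =
        2 * (total_rate k lambda * p n t
             - \sum_(1 <= j < (minn n k).+1) lambda j * p (n - j)%N t)].
Proof.
move=> p n t t0.
pose mu : {measure set (measurableTypeR R) -> \bar R} := @lebesgue_measure R.
pose D : set R := `]0, +oo[%classic.
have mD : measurable D by exact: measurable_itv.
(* The formula is for positive times; derivatives being local, it is transferred through
   [near_eq_is_derive] on a neighbourhood of each such time. *)
have pE j (s : R) : 0 < s ->
    p j s = 2 * \int[mu]_(y in D) (marginal M j (y ^- 2) * gauss_kernel s y).
  by move=> s0; exact: (subordinated_prob hM hB hMB s0 j).
pose F (ker : R -> R -> R) (s : R) :=
  2 * \int[mu]_(y in D) (marginal M n (y ^- 2) * ker s y).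
have dF (s : R) : 0 < s -> is_derive s 1 (F gauss_kernel) (F gauss_kernel1 s) /\
    is_derive s 1 (F gauss_kernel1) (F gauss_kernel2 s).
  move=> s0.
  have [h1 h2] := gauss_transform_derive2 mD (@measurable_marginal_inv_sqr _ _ _ _ _ _ _ hM n)
    (fun y _ => normr_marginal M n (y ^- 2)) s0.
  by split; rewrite /F; apply: is_derive_eq; rewrite /GRing.scale /= ?mulr0 ?addr0 ?add0r.
have near_pos (s : R) : 0 < s -> \forall x \near s, 0 < x by exact: lt_nbhsr.
have dp (s : R) : 0 < s -> is_derive s 1 (p n) (F gauss_kernel1 s).
  move=> s0; have [h _] := dF s s0.
  apply: near_eq_is_derive h; apply: filterS (near_pos s s0) => x x0.
  by rewrite pE.
have dp1 : is_derive t 1 (p n)^`()%classic (F gauss_kernel2 t).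
  have [_ h] := dF t t0.
  apply: near_eq_is_derive h; apply: filterS (near_pos t t0) => x x0.
  by rewrite derive1E; have ? := dp x x0; rewrite derive_val.
split.
- by have ? := dp t t0; exact: ex_derive.
- exact: ex_derive.
rewrite (_ : (p n)^`(2)%classic = ((p n)^`()%classic)^`()%classic)//.
rewrite derive1E derive_val /F.
have dq (s : R) : 0 < s -> is_derive s 1 (marginal M n) (marginal_derivative k lambda M n s).
  exact: is_derive_marginal.
have cq' (s : R) : 0 < s -> {for s, continuous (marginal_derivative k lambda M n)}.
  exact: continuous_marginal_derivative.
rewrite (gauss_kernel2_by_parts t0 dq (fun s _ => normr_marginal M n s)
  cq'
  (fun s _ => normr_marginal_derivative k lambda M n s)).
have -> : \int[mu]_(y in `]0, +oo[) (marginal_derivative k lambda M n (y ^- 2) * gauss_kernel t y) =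
    \sum_(i < n.+1) gcp_rate k lambda (n - i) *
      \int[mu]_(y in D) (marginal M i (y ^- 2) * gauss_kernel t y).
  rewrite -(Rintegral_linear_combination (mu := mu) (D := D) n.+1
    (fun i => gcp_rate k lambda (n - i))
    (f := fun i (y : R) => marginal M i (y ^- 2) * gauss_kernel t y)) //; last first.
    move=> j; apply: (integrable_kernel_bounded t0).
      exact: (@measurable_marginal_inv_sqr _ _ _ _ _ _ _ hM j).
    by move=> y _; exact: normr_marginal.
  apply: eq_Rintegral => y _; rewrite /marginal_derivative mulr_suml.
  by apply: eq_bigr => i _; rewrite mulrAC mulrC.
(* Each [p i t] is twice its integral, hence 2^-1. With the 2 in [F] and the -2 of the integration
   by parts the total factor is -2, whose sign cancels the one in [sum_gcp_rate]. *)
have -> : \sum_(i < n.+1) gcp_rate k lambda (n - i) *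
    \int[mu]_(y in D) (marginal M i (y ^- 2) * gauss_kernel t y) =
    2^-1 * \sum_(i < n.+1) p i t * gcp_rate k lambda (n - i).
  rewrite mulr_sumr; apply: eq_bigr => i _; rewrite pE//.
  by rewrite mulrA mulKf// mulrC.
rewrite (sum_gcp_rate _ _ (fun j => p j t)).
by field.
Qed.
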